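(* Fix $m\in(0,1)$ and $r_1\in(0,1)$. Let $p\ge1$ be an integer and let $F$ be a polyharmonic mapping in the unit disk $\mathbb{D}$ of the form $$F(z)=\sum_{n=1}^{p}|z|^{2(n-1)}\big(h_n(z)+\overline{g_n(z)}\big)=\sum_{n=1}^{p}|z|^{2(n-1)}\sum_{j=1}^{\infty}\big(a_{n,j}z^{j}+\overline{b_{n,j}}\,\overline{z}^{j}\big).$$ Suppose that $S_F(r_1)\le m$, $S_F(1)\le1$, $|a_{n,j}|\ge|b_{n,j}|$ for all $n\in\{1,\dots,p\}$ and $j\ge1$, and that for all $j\ge1$ and all $n_1\neq n_2$ in $\{1,\dots,p\}$, $$\left|\arg\left\{\frac{a_{n_1,j}}{a_{n_2,j}}\right\}\right|\le\frac{\pi}{2}\quad\text{whenever } a_{n_1,j},a_{n_2,j}\neq 0,\qquad \left|\arg\left\{\frac{b_{n_1,j}}{b_{n_2,j}}\right\}\right|\ge\frac{\pi}{2}\quad\text{whenever } b_{n_1,j},b_{n_2,j}\ne 0.$$ Then for all $r$ with $r_1\le r<1$, $$S_F(r)\le m^{\frac{\log r}{\log r_1}}.$$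
   Context: $\mathbb{D}_r=\{z\in\mathbb{C}:|z|<r\}$ and $\mathbb{D}=\mathbb{D}_1$. A complex-valued mapping $F$ is polyharmonic ($p$-harmonic) in a domain if $\Delta^pF=0$ there, where $\Delta=4\,\partial^2/\partial z\partial\overline z$. In the displayed form, $h_n(z)=\sum_{j\ge1}a_{n,j}z^j$ and $g_n(z)=\sum_{j\ge1}b_{n,j}z^j$ are analytic in $\mathbb{D}$ with complex coefficients. $J_F=|F_z|^2-|F_{\overline z}|^2$ is the Jacobian of $F$. The area function, counting multiplicity, is $S_F(r)=\int_{\mathbb{D}_r}J_F(z)\,d\sigma(z)$ for $0<r<1$, where $d\sigma=\frac1\pi\,dx\,dy$ is normalized Lebesgue area measure on $\mathbb{D}$, and $S_F(1)=\sup_{0<r<1}S_F(r)$. $\arg$ denotes the principal argument in $(-\pi,\pi]$. *)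

(* Defs.v *)
From HB Require Import structures.
From mathcomp Require Import all_boot all_order all_algebra.
From mathcomp Require Import complex.
From mathcomp Require Import all_classical all_reals all_analysis.

Set Implicit Arguments.
Unset Strict Implicit.
Unset Printing Implicit Defensive.

Import Order.TTheory GRing.Theory Num.Theory.
Import numFieldNormedType.Exports.
Import Normc.

Local Open Scope classical_set_scope.
Local Open Scope complex_scope.
Local Open Scope ring_scope.

Definition disk (R : realType) (r : R) : set R[i] := [set z | normc z < r].

Definition partial_x (R : realType) (F : R[i] -> R[i]) (z : R[i]) : R[i] :=
  derive1 (fun t : R => complex.Re (F (t +i* complex.Im z))) (complex.Re z) +i*
  derive1 (fun t : R => complex.Im (F (t +i* complex.Im z))) (complex.Re z).

Definition partial_y (R : realType) (F : R[i] -> R[i]) (z : R[i]) : R[i] :=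
  derive1 (fun t : R => complex.Re (F (complex.Re z +i* t))) (complex.Im z) +i*
  derive1 (fun t : R => complex.Im (F (complex.Re z +i* t))) (complex.Im z).

Definition partially_derivable (R : realType) (F : R[i] -> R[i]) (z : R[i]) :=
  [/\ derivable (fun t : R => complex.Re (F (t +i* complex.Im z))) (complex.Re z) 1,
      derivable (fun t : R => complex.Im (F (t +i* complex.Im z))) (complex.Re z) 1,
      derivable (fun t : R => complex.Re (F (complex.Re z +i* t))) (complex.Im z) 1 &
      derivable (fun t : R => complex.Im (F (complex.Re z +i* t))) (complex.Im z) 1].

(* Class C^k on the open set A in the sense of two real variables; the carrier
   R[i]^o is R[i] with the topology of the modulus. *)
Fixpoint class_C (R : realType) (k : nat) (A : set R[i]) (F : R[i] -> R[i])
    : Prop :=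
  (forall z, A z -> {for z, continuous (F : R[i]^o -> R[i]^o)}) /\
  (if k is k'.+1 then
     [/\ forall z, A z -> partially_derivable F z,
         class_C k' A (partial_x F) &
         class_C k' A (partial_y F)]
   else True).

Definition dz (R : realType) (F : R[i] -> R[i]) (z : R[i]) : R[i] :=
  (partial_x F z - ('i)%C * partial_y F z) / 2.

Definition dzbar (R : realType) (F : R[i] -> R[i]) (z : R[i]) : R[i] :=
  (partial_x F z + ('i)%C * partial_y F z) / 2.

Definition laplacian (R : realType) (F : R[i] -> R[i]) : R[i] -> R[i] :=
  fun z => 4 * dz (dzbar F) z.

Definition polyharmonic (R : realType) (p : nat) (A : set R[i])
    (F : R[i] -> R[i]) : Prop :=
  class_C (2 * p) A F /\ forall z, A z -> iter p (@laplacian R) F z = 0.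

Definition jac (R : realType) (F : R[i] -> R[i]) (z : R[i]) : R :=
  normc (dz F z) ^+ 2 - normc (dzbar F z) ^+ 2.

(* R[i] has no measurable structure in the libraries, hence the Cartesian
   coordinates w = (x, y); the factor 1 / pi normalizes the area measure. *)
Definition area (R : realType) (F : R[i] -> R[i]) (r : R) : \bar R :=
  ((pi^-1)%:E *
   \int[(@lebesgue_measure R \x @lebesgue_measure R)%E]_(w in
      [set w : R * R | disk r (w.1 +i* w.2)])
      (jac F (w.1 +i* w.2))%:E)%E.

(* The value at r = 1 of the area function is by convention the supremum of its
   values on ]0, 1[. *)
Definition area1 (R : realType) (F : R[i] -> R[i]) : \bar R :=
  ereal_sup [set area F r | r in `]0, 1[%classic].

(* The principal argument, in ]-pi, pi]; it is only meaningful for z != 0. *)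
Definition carg (R : realType) (z : R[i]) : R :=
  let t := acos (complex.Re z / normc z) in
  if 0 <= complex.Im z then t else - t.

Lemma cargP (R : realType) (z : R[i]) : z != 0 ->
  (- pi < carg z <= pi) /\
  z = (normc z * cos (carg z)) +i* (normc z * sin (carg z)).
Proof.
case: z => a b z0; rewrite /carg /=.
set n := Num.sqrt _; set t := acos _.
have s2 : 0 <= a ^+ 2 + b ^+ 2 by rewrite addr_ge0 ?sqr_ge0.
have n2 : n ^+ 2 = a ^+ 2 + b ^+ 2 by rewrite sqr_sqrtr.
have n_gt0 : 0 < n.
  rewrite lt_def sqrtr_ge0 andbT; apply: contra z0 => /eqP n0.
  by apply/eqP; apply: (@eq0_normc R (Complex a b)).
have nn0 := lt0r_neq0 n_gt0.
have c2 : 1 - (a / n) ^+ 2 = (b / n) ^+ 2.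
  by rewrite !expr_div_n -(@divff _ (n ^+ 2)) ?expf_neq0// -mulrBl n2 addrAC subrr add0r.
have c1 : -1 <= a / n <= 1.
  by rewrite -ler_norml -(@expr_le1 _ 2) ?normr_ge0// real_normK ?num_real// -subr_ge0 c2 sqr_ge0.
have [/andP[t0 tpi] ct] := acos_def c1.
have st : n * sin t = `|b|.
  by rewrite sin_acos// c2 sqrtr_sqr normrM normfV (gtr0_norm n_gt0) mulrCA divff ?mulr1.
have nc : n * cos t = a by rewrite ct mulrCA divff ?mulr1.
have pi0 := pi_gt0 R.
case: ifPn => b0; last rewrite cosN sinN mulrN.
  split; first by rewrite tpi andbT (lt_le_trans _ t0)// oppr_lt0.
  by rewrite nc st ger0_norm.
rewrite -ltNge in b0.
split; last by rewrite nc st ltr0_norm// opprK.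
rewrite (le_trans _ (ltW pi0)) ?oppr_le0// andbT ltrN2 lt_neqAle tpi andbT.
apply/eqP => tp; move: st; rewrite -/t tp sinpi mulr0 => /esym/eqP.
by rewrite normr_eq0 lt_eqF.
Qed.

(* h is the sum on the unit disk of the power series with coefficients c, which
   has no constant term: c 0 is ignored. *)
Definition power_series_sum (R : realType) (c : nat -> R[i]) (h : R[i] -> R[i])
    : Prop :=
  forall z, disk 1 z ->
    (fun N => \sum_(1 <= j < N.+1) c j * z ^+ j : R[i]^o) @ \oo -->
      (h z : R[i]^o).

(* Main.v *)
Require Import Defs.
From mathcomp Require Import all_boot all_order all_algebra.
From mathcomp Require Import complex.
From mathcomp Require Import all_classical all_reals all_analysis.
From mathcomp Require Import measurable_realfun.
From mathcomp Require Import ring lra zify.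

Import Order.TTheory GRing.Theory Num.Theory.
Import numFieldNormedType.Exports.
Import Normc.

Local Open Scope classical_set_scope.
Local Open Scope complex_scope.
Local Open Scope ring_scope.

Set Implicit Arguments.
Unset Strict Implicit.
Unset Printing Implicit Defensive.

(** Group the terms of F by frequency: on the circle of radius rho,
    F(rho e^(i t)) = sum_j (A_j(rho) e^(i j t) + conj(B_j(rho)) e^(- i j t)),
    where A_j(rho) = sum_n a_(n,j) rho^(2(n-1)+j) and B_j is formed in the
    same way from the b_(n,j).  By orthogonality of the exponentials the
    normalized area is
      S_F(r) = sum_j j (|A_j(r)|^2 - |B_j(r)|^2)
             = sum_j sum_(n,k) j Re(a_(n,j) conj a_(k,j) - b_(n,j) conj b_(k,j))
                                 r^(2j+2(n-1)+2(k-1)).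
    All coefficients of this series in r are nonnegative: for n = k because
    |b| <= |a|, and for n <> k because the conditions on the arguments make
    Re(a_n conj a_k) >= 0 and Re(b_n conj b_k) <= 0
    ([area_term_nneg_coefficients]).  For such series the three circles
    inequality is elementary ([three_circles_sum]): with t = ln r / ln r1, so
    that r = r1^t, the weighted inequality of arithmetic and geometric means
    gives m^(1-t) r^e <= t r1^e + (1-t) m for each exponent e; summed against
    the coefficients it yields
      m^(1-t) S(r) <= t S(r1) + (1-t) m S(1) <= m.
    It is applied to the partial sums, which lie below S_F.

    The formula for the area is proved first for polynomials in z and conj z
    and then carried to F by dominated convergence.

    For polynomials everything reduces to the integrals of z^a conj(z)^b over
    a disk ([moment]).  These come without polar coordinates: the function
    (r^2 - |z|^2) z^a conj(z)^b vanishes on the circle, so its derivatives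
    integrate to zero.  The resulting recursion lowers both exponents at once;
    when one of them reaches 0 the integral is 0, or the area of the disk if
    both do.

    For the limit, F is the pointwise limit of its truncations ([trunc]).
    The remainder of order two of z^a conj(z)^b at any point of the disk of
    radius rho is at most (a+b)^2 rho^(a+b-2) |z-w|^2 ([mono_taylor]), and the
    coefficients are summable against these weights ([weight_summable]).
    Hence the first order expansions of the truncations pass to the limit,
    the Wirtinger derivatives of F are the limits of those of the truncations
    ([limit_wirtinger]), and the Jacobians converge boundedly
    ([area_limit]). *)

(** * The modulus *)

Section Modulus.
Variable R : realType.
Implicit Types z w : R[i].

Lemma normc_ge0 z : 0 <= normc z.
Proof. by case: z => a b; exact: sqrtr_ge0. Qed.

Lemma normc_sqr z : normc z ^+ 2 = complex.Re z ^+ 2 + complex.Im z ^+ 2.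
Proof. by case: z => a b; rewrite /= sqr_sqrtr// addr_ge0// sqr_ge0. Qed.

Lemma normcJ z : normc (conjc z) = normc z.
Proof. by case: z => a b; rewrite /= sqrrN. Qed.

Lemma normcX z n : normc (z ^+ n) = normc z ^+ n.
Proof.
elim: n => [|n IH]; first by rewrite !expr0 normc1.
by rewrite !exprS normcM IH.
Qed.

Lemma normcR (x : R) : normc x%:C = `|x|.
Proof. by rewrite /= expr0n addr0 sqrtr_sqr. Qed.

Lemma normc_nat n : normc (n%:R : R[i]) = n%:R.
Proof.
rewrite -(rmorph_nat (real_complex R)) normcR ger0_norm//.
Qed.

Lemma normc_sum (I : Type) (s : seq I) (P : pred I) (f : I -> R[i]) :
  normc (\sum_(i <- s | P i) f i) <= \sum_(i <- s | P i) normc (f i).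
Proof.
elim/big_rec2 : _ => [|i x y _ h]; first by rewrite normc0.
by apply: (le_trans (le_normcD _ _)); rewrite lerD2l.
Qed.

Lemma Re_le_normc z : `|complex.Re z| <= normc z.
Proof.
rewrite -(@ler_pXn2r _ 2)// ?nnegrE ?normc_ge0// normc_sqr real_normK ?num_real//.
by rewrite lerDl sqr_ge0.
Qed.

Lemma Im_le_normc z : `|complex.Im z| <= normc z.
Proof.
rewrite -(@ler_pXn2r _ 2)// ?nnegrE ?normc_ge0// normc_sqr real_normK ?num_real//.
by rewrite lerDr sqr_ge0.
Qed.

Lemma normc_le_ReIm z :
  normc z <= `|complex.Re z| + `|complex.Im z|.
Proof.
rewrite -(@ler_pXn2r _ 2)// ?nnegrE ?normc_ge0 ?addr_ge0// normc_sqr sqrrD.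
by rewrite !real_normK ?num_real// addrAC lerDl mulrn_wge0// mulr_ge0.
Qed.

Lemma ReD z w : complex.Re (z + w) = complex.Re z + complex.Re w.
Proof. by case: z w => ? ? [? ?]. Qed.
Lemma ImD z w : complex.Im (z + w) = complex.Im z + complex.Im w.
Proof. by case: z w => ? ? [? ?]. Qed.
Lemma ReM z w : complex.Re (z * w) =
  complex.Re z * complex.Re w - complex.Im z * complex.Im w.
Proof. by case: z w => ? ? [? ?]. Qed.
Lemma ImM z w : complex.Im (z * w) =
  complex.Re z * complex.Im w + complex.Im z * complex.Re w.
Proof. by case: z w => ? ? [? ?]. Qed.
Lemma ReN z : complex.Re (- z) = - complex.Re z.
Proof. by case: z. Qed.
Lemma ImN z : complex.Im (- z) = - complex.Im z.
Proof. by case: z. Qed.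
Lemma ReJ z : complex.Re (conjc z) = complex.Re z.
Proof. by case: z. Qed.
Lemma ImJ z : complex.Im (conjc z) = - complex.Im z.
Proof. by case: z. Qed.

Lemma mulcJ z : z * conjc z = (normc z ^+ 2)%:C.
Proof. by case: z => a b; rewrite normc_sqr/=; simpc; congr (_ +i* _); ring. Qed.

Lemma complex_eta z : z = complex.Re z +i* complex.Im z.
Proof. by case: z. Qed.

Lemma Re_sum (I : Type) (s : seq I) (P : pred I) (f : I -> R[i]) :
  complex.Re (\sum_(i <- s | P i) f i) = \sum_(i <- s | P i) complex.Re (f i).
Proof. by elim/big_rec2 : _ => [//|i x y _ <-]; rewrite ReD. Qed.

Lemma Im_sum (I : Type) (s : seq I) (P : pred I) (f : I -> R[i]) :
  complex.Im (\sum_(i <- s | P i) f i) = \sum_(i <- s | P i) complex.Im (f i).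
Proof. by elim/big_rec2 : _ => [//|i x y _ <-]; rewrite ImD. Qed.

End Modulus.

(** * Wirtinger derivatives with a quadratic remainder *)

Section Wirtinger.
Variable R : realType.
Implicit Types (z w P Q : R[i]) (F : R[i] -> R[i]).

(** The remainder is asked to be quadratic, rather than merely of smaller
    order than z - w, because a bound with a uniform constant survives
    pointwise limits of F, P and Q; this spares any theorem on termwise
    differentiation. *)
Definition wirtinger F w P Q := exists C : R, exists2 e : R, 0 < e &
  forall z, normc (z - w) < e ->
  normc (F z - F w - (P * (z - w) + Q * conjc (z - w))) <=
    C * normc (z - w) ^+ 2.

Lemma is_derive_quadratic (f : R -> R) (x l C e : R) : 0 < e ->
  (forall t, `|t - x| < e -> `|f t - f x - l * (t - x)| <= C * (t - x) ^+ 2) ->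
  is_derive x 1 f l.
Proof.
move=> e0 H.
have L : (fun h => h^-1 *: (f (h *: 1 + x) - f x)) @ 0^' --> l.
  apply/cvgrPdist_le => d d0.
  pose C' := Num.max C 1.
  have C'0 : 0 < C' by rewrite lt_max ltr01 orbT.
  have m0 : 0 < Num.min e (d / C') by rewrite lt_min e0 divr_gt0.
  near=> h.
  have h0 : h != 0 by near: h; exact: nbhs_dnbhs_neq.
  have : `|h| < Num.min e (d / C').
    by near: h; apply: dnbhs0_lt.
  rewrite lt_min => /andP[he hd].
  have := H (h + x); rewrite addrK => /(_ he) Hh.
  have -> : h *: (1:R) = h by rewrite /GRing.scale/= mulr1.
  rewrite distrC.
  have -> : h^-1 *: (f (h + x) - f x) - l = h^-1 * (f (h + x) - f x - l * h).
    by rewrite mulrBr mulrCA mulVf// mulr1.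
  rewrite normrM normfV ler_pdivrMl ?normr_gt0//.
  apply: (le_trans Hh).
  rewrite -normr_id -(ger0_norm (sqr_ge0 h)) normrX.
  rewrite expr2 normr_id mulrCA ler_wpM2l//.
  apply: (@le_trans _ _ (C' * `|h|)).
    by rewrite ler_wpM2r// le_max lexx.
  by rewrite mulrC -ler_pdivlMr// ltW.
apply: DeriveDef; first by apply/cvg_ex; exists l.
exact: (cvg_lim _ L).
Unshelve. all: by end_near. Qed.

(** Moving along a horizontal line makes conj(z - w) equal to z - w, and along
    a vertical one makes it equal to its opposite. *)
Lemma wirtinger_derive F w P Q : wirtinger F w P Q ->
  [/\ is_derive (complex.Re w) 1 (fun t => complex.Re (F (t +i* complex.Im w)))
        (complex.Re (P + Q)),
      is_derive (complex.Re w) 1 (fun t => complex.Im (F (t +i* complex.Im w)))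
        (complex.Im (P + Q)),
      is_derive (complex.Im w) 1 (fun t => complex.Re (F (complex.Re w +i* t)))
        (complex.Re ('i%C * (P - Q))) &
      is_derive (complex.Im w) 1 (fun t => complex.Im (F (complex.Re w +i* t)))
        (complex.Im ('i%C * (P - Q)))].
Proof.
case: w => x y [C [e e0 H]] /=.
have Hx t : `|t - x| < e -> normc (F (t +i* y) - F (x +i* y)
    - (t - x)%:C * (P + Q)) <= C * (t - x) ^+ 2.
  move=> te; have := H (t +i* y).
  have -> : (t +i* y) - (x +i* y) = (t - x)%:C by simpc.
  rewrite normcR real_normK ?num_real// conjc_real => /(_ te).
  by rewrite -mulrDl [_ * (P + Q)]mulrC.
have Hy t : `|t - y| < e -> normc (F (x +i* t) - F (x +i* y)
    - (t - y)%:C * ('i%C * (P - Q))) <= C * (t - y) ^+ 2.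
  move=> te; have := H (x +i* t).
  have E : (x +i* t) - (x +i* y) = 'i%C * (t - y)%:C by simpc.
  rewrite E normcM normcR [normc 'i%C]/= expr0n expr1n add0r sqrtr1 mul1r.
  rewrite real_normK ?num_real// => /(_ te).
  have -> : conjc ('i%C * (t - y)%:C) = - ('i%C * (t - y)%:C).
    by apply/eqP; rewrite eq_complex /=; apply/andP; split; apply/eqP; ring.
  congr (normc (_ - _) <= _).
  by rewrite mulrN -mulrBl; ring.
have RE (a : R) z : complex.Re (a%:C * z) = complex.Re z * a.
  by rewrite ReM /= mul0r subr0 mulrC.
have IE (a : R) z : complex.Im (a%:C * z) = complex.Im z * a.
  by rewrite ImM /= mul0r addr0 mulrC.
split; apply: (is_derive_quadratic (C := C) e0) => t te.
- apply: le_trans (Hx t te); apply: le_trans (Re_le_normc _).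
  by rewrite !ReD !ReN RE ReD.
- apply: le_trans (Hx t te); apply: le_trans (Im_le_normc _).
  by rewrite !ImD !ImN IE ImD.
- apply: le_trans (Hy t te); apply: le_trans (Re_le_normc _).
  by rewrite !ReD !ReN RE.
- apply: le_trans (Hy t te); apply: le_trans (Im_le_normc _).
  by rewrite !ImD !ImN IE.
Qed.

Lemma wirtinger_dz F w P Q : wirtinger F w P Q -> dz F w = P /\ dzbar F w = Q.
Proof.
move=> /wirtinger_derive[d1 d2 d3 d4].
rewrite /dz /dzbar /partial_x /partial_y !derive1E !derive_val.
rewrite -!complex_eta.
have ii : 'i%C * 'i%C = -1 :> R[i] by rewrite -expr2 sqr_i.
have n2 : (2 : R[i]) != 0 by rewrite pnatr_eq0.
split.
- by rewrite mulrA ii; field.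
- by rewrite mulrA ii; field.
Qed.

Lemma wirtingerB F1 F2 w P1 Q1 P2 Q2 :
  wirtinger F1 w P1 Q1 -> wirtinger F2 w P2 Q2 ->
  wirtinger (fun z => F1 z - F2 z) w (P1 - P2) (Q1 - Q2).
Proof.
move=> [C1 [e1 e10 H1]] [C2 [e2 e20 H2]].
exists (C1 + C2); exists (Num.min e1 e2); first by rewrite lt_min e10.
move=> z; rewrite lt_min => /andP[/H1 h1 /H2 h2].
rewrite [leRHS]mulrDl; apply: (le_trans _ (lerD h1 h2)).
rewrite -(normcN (F2 z - _ - _)).
set u1 := P1 * _ + _; set u2 := P2 * _ + _.
have -> : F1 z - F2 z - (F1 w - F2 w) - ((P1 - P2) * (z - w) +
    (Q1 - Q2) * conjc (z - w)) = F1 z - F1 w - u1 + - (F2 z - F2 w - u2).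
  by rewrite /u1 /u2; ring.
exact: le_normcD.
Qed.

Lemma wirtingerZ F w P Q (k : R[i]) : wirtinger F w P Q ->
  wirtinger (fun z => k * F z) w (k * P) (k * Q).
Proof.
move=> [C [e e0 H]]; exists (normc k * C); exists e => // z /H h.
have -> : k * F z - k * F w - (k * P * (z - w) + k * Q * conjc (z - w)) =
  k * (F z - F w - (P * (z - w) + Q * conjc (z - w))) by ring.
by rewrite normcM -mulrA ler_wpM2l// normc_ge0.
Qed.

Definition mono (a b : nat) z := z ^+ a * conjc z ^+ b.
Definition mono_z (a b : nat) z := a%:R * z ^+ a.-1 * conjc z ^+ b.
Definition mono_zbar (a b : nat) z := b%:R * z ^+ a * conjc z ^+ b.-1.

Lemma mono_bound (rho : R) a b w : normc w <= rho ->
  normc (mono a b w) <= rho ^+ (a + b).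
Proof.
move=> wr; rewrite /mono normcM !normcX normcJ -exprD.
by rewrite lerXn2r// nnegrE ?normc_ge0// (le_trans _ wr)// normc_ge0.
Qed.

Lemma mono_z_bound (rho : R) a b w : normc w <= rho ->
  rho * normc (mono_z a b w) <= a%:R * rho ^+ (a + b).
Proof.
move=> wr; have r0 : 0 <= rho by rewrite (le_trans _ wr)// normc_ge0.
rewrite /mono_z; case: a => [|a]; first by rewrite !mul0r normc0 mulr0.
rewrite addSn exprS -mulrA normcM normc_nat mulrCA ler_wpM2l// ler_wpM2l//.
exact: mono_bound.
Qed.

Lemma mono_zbar_bound (rho : R) a b w : normc w <= rho ->
  rho * normc (mono_zbar a b w) <= b%:R * rho ^+ (a + b).
Proof.
move=> wr; have r0 : 0 <= rho by rewrite (le_trans _ wr)// normc_ge0.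
rewrite /mono_zbar; case: b => [|b]; first by rewrite !mul0r normc0 mulr0.
rewrite addnS exprS -mulrA normcM normc_nat mulrCA ler_wpM2l// ler_wpM2l//.
exact: mono_bound.
Qed.

(** By induction on the exponents. If f has first order part d at w, then the
    remainder of u f, for u = z or u = conj z, is u times the remainder of f
    plus (u - u0) d, and (k^2 + k) <= (k+1)^2. Both sides carry a factor rho^2
    so that no exponent a + b - 2 has to be written. *)
Lemma mono_taylor (rho : R) a b z w : 0 <= rho ->
  normc z <= rho -> normc w <= rho ->
  rho ^+ 2 * normc (mono a b z - mono a b w -
      (mono_z a b w * (z - w) + mono_zbar a b w * conjc (z - w))) <=
    (a + b)%:R ^+ 2 * rho ^+ (a + b) * normc (z - w) ^+ 2.
Proof.
move=> r0 zr wr; set h : R[i] := z - w.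
have step (u u0 f f0 d : R[i]) (k : nat) : normc u <= rho ->
    normc (u - u0) = normc h -> rho * normc d <= k%:R * rho ^+ k * normc h ->
    rho ^+ 2 * normc (f - f0 - d) <= k%:R ^+ 2 * rho ^+ k * normc h ^+ 2 ->
    rho ^+ 2 * normc (u * f - u0 * f0 - ((u - u0) * f0 + u0 * d)) <=
      k.+1%:R ^+ 2 * rho ^+ k.+1 * normc h ^+ 2.
  move=> ur uh dk fk.
  have -> : u * f - u0 * f0 - ((u - u0) * f0 + u0 * d) =
    u * (f - f0 - d) + (u - u0) * d by ring.
  apply: le_trans (ler_wpM2l _ (le_normcD _ _)) _; first exact: sqr_ge0.
  rewrite mulrDr !normcM uh.
  apply: (@le_trans _ _ (rho * (k%:R ^+ 2 * rho ^+ k * normc h ^+ 2) +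
      rho * normc h * (k%:R * rho ^+ k * normc h))).
    apply: lerD.
      rewrite mulrCA; apply: ler_pM => //; rewrite ?normc_ge0//.
      by rewrite mulr_ge0 ?sqr_ge0 ?normc_ge0.
    have -> : rho ^+ 2 * (normc h * normc d) = rho * normc h * (rho * normc d).
      by ring.
    by rewrite ler_wpM2l// mulr_ge0// normc_ge0.
  have -> : rho * (k%:R ^+ 2 * rho ^+ k * normc h ^+ 2) +
      rho * normc h * (k%:R * rho ^+ k * normc h) =
      (k%:R ^+ 2 + k%:R) * (rho ^+ k.+1 * normc h ^+ 2) by rewrite (exprS rho
        k); ring.
  rewrite -mulrA; apply: ler_wpM2r.
    by rewrite mulr_ge0 ?exprn_ge0 ?normc_ge0.
  rewrite -natr1 sqrrD expr1n mulr1 -addrA lerD2l mulr2n -addrA lerDl.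
  by rewrite addr_ge0.
have dbound m n : rho * normc (mono_z m n w * h + mono_zbar m n w * conjc h) <=
    (m + n)%:R * rho ^+ (m + n) * normc h.
  apply: le_trans (ler_wpM2l r0 (le_normcD _ _)) _.
  rewrite (normcM (mono_z m n w)) (normcM (mono_zbar m n w)) normcJ.
  rewrite mulrDr !mulrA natrD !mulrDl.
  by apply: lerD; apply: ler_wpM2r;
    rewrite ?normc_ge0 ?mono_z_bound ?mono_zbar_bound.
elim: a => [|a IH].
  elim: b => [|b IH].
    rewrite /mono /mono_z /mono_zbar !expr0 !mul1r !mul0r subrr addr0 subr0.
    by rewrite normc0 mulr0 !mulr_ge0 ?sqr_ge0 ?exprn_ge0 ?normc_ge0.
  rewrite add0n; rewrite add0n in IH.
  have Jh : conjc z - conjc w = conjc h by rewrite /h raddfB.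
  have := step (conjc z) (conjc w) _ _ _ b _ _ (dbound 0%N b) IH.
  rewrite Jh !normcJ => /(_ zr erefl).
  apply: le_trans; rewrite le_eqVlt; apply/orP; left; apply/eqP.
  congr (_ * normc _); rewrite /mono /mono_z /mono_zbar !expr0 !mul0r !mul1r
    !exprS.
  case: b {IH} => [|b]; first by rewrite ?expr0; ring.
  by rewrite /= (exprS (conjc w) b) -[b.+2%:R]natr1; ring.
have := step z w _ _ _ (a + b)%N zr erefl (dbound a b) IH.
apply: le_trans; rewrite le_eqVlt; apply/orP; left; apply/eqP.
congr (_ * normc _); rewrite -/h /mono /mono_z /mono_zbar !exprS.
case: a {IH} => [|a]; first by rewrite ?expr0; ring.
by rewrite /= (exprS w a) -[a.+2%:R]natr1; ring.
Qed.

Lemma wirtinger_mono a b w : wirtinger (mono a b) w (mono_z a b w) (mono_zbar a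
  b w).
Proof.
set rho := normc w + 1.
have r0 : 0 < rho by rewrite ltr_wpDl// normc_ge0.
exists ((a + b)%:R ^+ 2 * rho ^+ (a + b) / rho ^+ 2); exists 1 => // z z1.
have zr : normc z <= rho.
  rewrite -(subrK w z); apply: (le_trans (le_normcD _ _)).
  by rewrite addrC lerD2l ltW.
rewrite [leRHS]mulrAC ler_pdivlMr ?exprn_gt0// mulrC.
by apply: mono_taylor => //; [exact: ltW|rewrite lerDl].
Qed.

End Wirtinger.

(** * The area of a disk *)

Section DiskMoments.
Variable R : realType.
Implicit Types (r : R) (f g F : R[i] -> R[i]).

Local Notation mu := (@lebesgue_measure R).
Local Notation mu2 := (mu \x mu)%E.
Local Notation cpt w := (w.1 +i* w.2).

(** The plane is spelled with the measurable structure on which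
    [lebesgue_measure] is defined. *)
Definition planar_disk r : set (measurableTypeR R * measurableTypeR R) :=
  [set w | disk r (cpt w)].

Lemma planar_diskE r : 0 < r ->
  planar_disk r = [set w | w.1 ^+ 2 + w.2 ^+ 2 < r ^+ 2].
Proof.
move=> r0; apply/seteqP; split => w; rewrite /planar_disk /disk/=.
  by rewrite -(ltr_pXn2r (n:=2))// ?nnegrE ?sqrtr_ge0 ?(ltW r0)// sqr_sqrtr//
    addr_ge0// sqr_ge0.
by rewrite -(ltr_pXn2r (n:=2) _ (x := Num.sqrt _))// ?nnegrE ?sqrtr_ge0 ?(ltW
  r0)// sqr_sqrtr// addr_ge0// sqr_ge0.
Qed.

Lemma measurable_planar_disk r : 0 < r -> measurable (planar_disk r).
Proof.
move=> r0; rewrite planar_diskE//.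
rewrite [X in measurable X](_ : _ = setT `&` (fun w : measurableTypeR R *
  measurableTypeR R =>
   w.1 ^+ 2 + w.2 ^+ 2 < r ^+ 2) @^-1` [set true]); last first.
  by rewrite setTI; apply/seteqP; split => w /=.
apply: measurable_fun_ltr => //; apply: measurable_funD => //;
  apply: measurable_funX => //.
Qed.

(** The formula also covers the empty sections, since the square root of a
    negative number is 0. *)
Lemma lebesgue_disk_section r (x : R) :
  mu [set y | x ^+ 2 + y ^+ 2 < r ^+ 2] = (2 * Num.sqrt (r ^+ 2 - x ^+ 2))%:E.
Proof.
set s := Num.sqrt _.
have s0 : 0 <= s by exact: sqrtr_ge0.
have -> : [set y | x ^+ 2 + y ^+ 2 < r ^+ 2] = `]-s, s[%classic.
  apply/seteqP; split => y /=;
    rewrite in_itv/= -ltr_norml -sqrtr_sqr addrC -ltrBrDr.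
    by move=> h; rewrite ltr_sqrt// (le_lt_trans _ h)// sqr_ge0.
  move=> h; have p0 : 0 < r ^+ 2 - x ^+ 2.
    by rewrite -sqrtr_gt0 (le_lt_trans _ h)// sqrtr_ge0.
  by rewrite ltr_sqrt in h.
rewrite lebesgue_measure_itv/= lte_fin.
have [ss|ss] := ltP (- s) s.
  by rewrite -EFinB opprK -mulr2n mulr_natl.
have -> : s = 0.
  by apply/eqP; rewrite eq_le s0 andbT; move: ss;
    rewrite lerNr -subr_le0 opprK -mulr2n pmulrn_lle0.
by rewrite mulr0.
Qed.

(** Fubini turns the area into the integral of the lengths of the chords,
    which the substitution x = r sin t makes elementary. *)
Lemma area_planar_disk r : 0 < r -> mu2 (planar_disk r) = (pi * r ^+ 2)%:E.
Proof.
move=> r0; rewrite planar_diskE// /product_measure1/=.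
transitivity (\int[mu]_x (2 * Num.sqrt (r ^+ 2 - x ^+ 2))%:E)%E.
  apply: eq_integral => x _ /=; rewrite -lebesgue_disk_section; congr (mu _).
  by apply/seteqP; split => y; rewrite /xsection/= ?inE.
transitivity (\int[mu]_(x in `[(- r)%R, r]) (2 * Num.sqrt (r ^+ 2 - x ^+
  2))%:E)%E.
  rewrite [RHS]integral_mkcond; apply: eq_integral => x _.
  rewrite patchE; case: ifPn => // /negP;
    rewrite inE/= in_itv/= -ler_norml => /negP.
  rewrite -ltNge => h; rewrite ler0_sqrtr ?mulr0//.
  by rewrite subr_le0 -[leRHS]real_normK ?num_real// lerXn2r// ?nnegrE ?ltW//
    (le_trans (ltW r0))// ltW.
have pi2 : - (pi / 2) < pi / 2 :> R.
  by rewrite -subr_gt0 opprK -splitr pi_gt0.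
pose S (t : R) := r * sin t.
have dS (t : R) : is_derive t 1 S (r * cos t).
  by rewrite /S; apply: is_deriveZ.
have S' : derive1 S = fun t => r * cos t.
  by apply/funext => t; rewrite derive1E; apply: derive_val.
have cS' : continuous (fun t : R => r * cos t).
  by move=> t; apply: cvgM; [exact: cvg_cst|exact: continuous_cos].
have cS : continuous S.
  by move=> t; apply: cvgM; [exact: cvg_cst|exact: continuous_sin].
have SN : S (- (pi / 2)) = - r by rewrite /S sinN sin_pihalf mulrN1.
have SP : S (pi / 2) = r by rewrite /S sin_pihalf mulr1.
rewrite -[in LHS]SN -[X in `[_, X]]SP.
rewrite (@integration_by_substitution_increasing _ S); first last.
- apply: continuous_subspaceT => x; apply: cvgM; first exact: cvg_cst.
  apply: (@continuous_comp _ _ _ (fun x : R => r ^+ 2 - x ^+ 2) Num.sqrt);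
    last exact: sqrt_continuous.
  by apply: cvgB; [exact: cvg_cst|exact: exprn_continuous].
- split; first by move=> t _; exact: ex_derive.
  + exact: cvg_at_right_filter (cS _).
  + exact: cvg_at_left_filter (cS _).
- by rewrite S'; apply: cvgP; apply: cvg_at_left_filter; exact: cS'.
- by rewrite S'; apply: cvgP; apply: cvg_at_right_filter; exact: cS'.
- by rewrite S' => t _; exact: cS'.
- move=> s t; rewrite !in_itv/= => s1 t1 st; rewrite /S ltr_pM2l//.
  by rewrite ltr_sin// in_itv/=.
- exact: ltW.
rewrite S'.
pose T (t : R) := r ^+ 2 * (t + sin t * cos t).
have dT (t : R) : is_derive t 1 T (r ^+ 2 * (1 + (sin t * (- sin t) + cos t *
  cos t))).
  by rewrite /T; apply: is_deriveZ.
transitivity (\int[mu]_(t in `[(- (pi / 2))%R, (pi / 2)%R])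
   (r ^+ 2 * (1 + (sin t * (- sin t) + cos t * cos t)))%:E)%E.
  apply: eq_integral => t; rewrite inE/= in_itv/= => tp; congr EFin.
  rewrite !fctE /S.
  have -> : r ^+ 2 - (r * sin t) ^+ 2 = (r * cos t) ^+ 2.
    by rewrite !exprMn cos2sin2; ring.
  rewrite sqrtr_sqr ger0_norm; last by rewrite mulr_ge0 ?cos_ge0_pihalf// ltW.
  have := cos2Dsin2 t => e.
  have -> : 1 + (sin t * - sin t + cos t * cos t) = 2 * cos t ^+ 2.
    by rewrite -[X in X + _]e; ring.
  by ring.
rewrite (@continuous_FTC2 _ _ T)//; first last.
- by move=> t _; rewrite derive1E; apply: derive_val.
- have cT : continuous T.
    move=> t; apply: differentiable_continuous; apply/derivable1_diffP.
    by have [] := dT t.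
  split; first by move=> t _; exact: ex_derive.
  + exact: cvg_at_right_filter (cT _).
  + exact: cvg_at_left_filter (cT _).
- apply: continuous_subspaceT => t.
  apply: cvgM; first exact: cvg_cst.
  apply: cvgD; first exact: cvg_cst.
  apply: cvgD; apply: cvgM; rewrite ?cvgN; try exact: continuous_sin;
    try exact: continuous_cos.
  by apply: cvgN; exact: continuous_sin.
by rewrite -EFinB /T cosN !cos_pihalf !mulr0 !addr0 -mulrBr opprK -splitr mulrC.
Qed.

End DiskMoments.

(** * Integrals of derivatives of functions vanishing on the circle *)

Section Green.
Variable R : realType.
Implicit Types (r : R) (F : R[i] -> R[i]).

Local Notation mu := (@lebesgue_measure R).
Local Notation mu2 := (mu \x mu)%E.
Local Notation cpt w := (w.1 +i* w.2).

(** The square of the other coordinate is the constant c, so that the line of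
    integration meets the disk in the chord t^2 + c < r^2, at whose endpoints
    Q vanishes. *)
Lemma chord_integral0 r (c : R) (q Q : R -> R) : 0 < r -> continuous q ->
  (forall t : R, is_derive t 1 Q (q t)) ->
  (forall t, t ^+ 2 + c = r ^+ 2 -> Q t = 0) ->
  (\int[mu]_t (((q \_ [set t | (t ^+ 2 + c < r ^+ 2)%R]) t)%:E) = 0)%E.
Proof.
move=> r0 cq dQ Q0.
have [cr|cr] := leP (r ^+ 2) c.
  rewrite (_ : [set t | t ^+ 2 + c < r ^+ 2] = set0); last first.
    apply/seteqP; split => t //=; rewrite ltNge (le_trans cr)//.
    by rewrite lerDr sqr_ge0.
  by rewrite patch_set0; under eq_integral do rewrite /=; rewrite integral0.
pose s := Num.sqrt (r ^+ 2 - c).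
have s0 : 0 < s by rewrite sqrtr_gt0 subr_gt0.
have ss : s ^+ 2 = r ^+ 2 - c by rewrite sqr_sqrtr// subr_ge0 ltW.
have -> : [set t | t ^+ 2 + c < r ^+ 2] = `]-s, s[%classic.
  apply/seteqP; split => t /=; rewrite in_itv/= -ltr_norml -ltrBrDr -ss.
    by rewrite -[in X in X -> _](real_normK (num_real t)) ltr_pXn2r// ?nnegrE//
      ltW.
  by rewrite -(real_normK (num_real t)) ltr_pXn2r// ?nnegrE// ltW.
under eq_integral do rewrite -[X in X%:E]/((_ \_ _) _) -[_%:E]/((EFin \o _) _)
  -restrict_EFin.
rewrite -integral_mkcond.
rewrite -(@integral_itv_bndoo _ _ _ _ true false); last first.
  by apply/measurable_EFinP; apply: measurable_funTS;
    exact: continuous_measurable_fun.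
have cQ : continuous Q.
  move=> t; apply: differentiable_continuous; apply/derivable1_diffP.
  by have [] := dQ t.
rewrite /= (@continuous_FTC2 _ _ Q)//.
- by rewrite !Q0 ?subee// ?sqrrN ss subrK.
- by rewrite gtrN.
- exact: continuous_subspaceT.
- split; first by move=> t _; exact: ex_derive.
  + exact: cvg_at_right_filter (cQ _).
  + exact: cvg_at_left_filter (cQ _).
- by move=> t _; rewrite derive1E; apply: derive_val.
Qed.

Lemma disk_integral_dx0 r (q Q : R -> R -> R) : 0 < r ->
  mu2.-integrable (planar_disk r) (fun w => (q w.1 w.2)%:E) ->
  (forall y, continuous (q^~ y)) ->
  (forall x y : R, is_derive x 1 (Q^~ y) (q x y)) ->
  (forall x y, x ^+ 2 + y ^+ 2 = r ^+ 2 -> Q x y = 0) ->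
  \int[mu2]_(w in planar_disk r) q w.1 w.2 = 0.
Proof.
move=> r0 iq cq dQ Q0; rewrite /Rintegral.
have {}iq := (integrable_mkcond _ (measurable_planar_disk r0)).1 iq.
rewrite integral_mkcond -(integral21_prod_meas1 iq) /fubini_G.
rewrite (eq_integral (cst 0%E)) ?integral0// => y _.
rewrite -[RHS](chord_integral0 (c := y ^+ 2) r0 (cq y) (dQ ^~ y) (Q0 ^~ y)).
apply: eq_integral => x _; rewrite !patchE planar_diskE//.
have -> : ((x, y) \in [set w : measurableTypeR R * measurableTypeR R |
    w.1 ^+ 2 + w.2 ^+ 2 < r ^+ 2]) = (x \in [set t | t ^+ 2 + y ^+ 2 < r ^+ 2]).
  by apply/idP/idP; rewrite !inE/=.
by case: ifP.
Qed.

Lemma disk_integral_dy0 r (q Q : R -> R -> R) : 0 < r ->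
  mu2.-integrable (planar_disk r) (fun w => (q w.1 w.2)%:E) ->
  (forall x, continuous (q x)) ->
  (forall x y : R, is_derive y 1 (Q x) (q x y)) ->
  (forall x y, x ^+ 2 + y ^+ 2 = r ^+ 2 -> Q x y = 0) ->
  \int[mu2]_(w in planar_disk r) q w.1 w.2 = 0.
Proof.
move=> r0 iq cq dQ Q0; rewrite /Rintegral.
have {}iq := (integrable_mkcond _ (measurable_planar_disk r0)).1 iq.
rewrite integral_mkcond -(integral12_prod_meas1 iq) /fubini_F.
rewrite (eq_integral (cst 0%E)) ?integral0// => x _.
have Q0' t : t ^+ 2 + x ^+ 2 = r ^+ 2 -> Q x t = 0 by rewrite addrC; exact: Q0.
rewrite -[RHS](chord_integral0 (c := x ^+ 2) r0 (cq x) (dQ x) Q0').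
apply: eq_integral => y _; rewrite !patchE planar_diskE//.
have -> : ((x, y) \in [set w : measurableTypeR R * measurableTypeR R |
    w.1 ^+ 2 + w.2 ^+ 2 < r ^+ 2]) = (y \in [set t | t ^+ 2 + x ^+ 2 < r ^+ 2]).
  by apply/idP/idP; rewrite !inE/= addrC.
by case: ifP.
Qed.

End Green.

(** * The moments of a disk *)

Section Moments.
Variable R : realType.
Implicit Types (r : R) (F P Q : R[i] -> R[i]) (k : R[i]).

Local Notation mu := (@lebesgue_measure R).
Local Notation mu2 := (mu \x mu)%E.
Local Notation cpt w := (w.1 +i* w.2).
Local Notation plane := (measurableTypeR R * measurableTypeR R)%type.

(** Both components are needed for each component of a complex multiple of F.
    *)
Definition cintegrable r F :=
  mu2.-integrable (planar_disk r) (fun w => (complex.Re (F (cpt w)))%:E) /\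
  mu2.-integrable (planar_disk r) (fun w => (complex.Im (F (cpt w)))%:E).

Definition cint r F : R[i] :=
  (\int[mu2]_(w in planar_disk r) complex.Re (F (cpt w))) +i*
  (\int[mu2]_(w in planar_disk r) complex.Im (F (cpt w))).

Lemma eq_cint r F P : F =1 P -> cint r F = cint r P.
Proof. by move=> /funext ->. Qed.

Lemma cintegrableD r F P : 0 < r -> cintegrable r F -> cintegrable r P ->
  cintegrable r (fun z => F z + P z).
Proof.
move=> r0 [F1 F2] [P1 P2]; have mD := measurable_planar_disk r0.
split.
- by apply: eq_integrable (integrableD mD F1 P1) => // w _ /=; rewrite ReD.
- by apply: eq_integrable (integrableD mD F2 P2) => // w _ /=; rewrite ImD.
Qed.

Lemma cintegrableZ r F k : 0 < r -> cintegrable r F ->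
  cintegrable r (fun z => k * F z).
Proof.
move=> r0 [F1 F2]; have mD := measurable_planar_disk r0.
split.
- apply: eq_integrable (integrableB mD
    (integrableZl mD (complex.Re k) F1) (integrableZl mD (complex.Im k) F2)) =>
      //.
  by move=> w _ /=; rewrite ReM.
- apply: eq_integrable (integrableD mD
    (integrableZl mD (complex.Re k) F2) (integrableZl mD (complex.Im k) F1)) =>
      //.
  by move=> w _ /=; rewrite ImM.
Qed.

Lemma cintegrable_sum r (I : Type) (s : seq I) (G : I -> R[i] -> R[i]) : 0 < r ->
  (forall i, cintegrable r (G i)) ->
  cintegrable r (fun z => \sum_(i <- s) G i z).
Proof.
move=> r0 iG; elim: s => [|i s IH].
  under eq_fun do rewrite big_nil.
  by split => /=; exact: integrable0.
under eq_fun do rewrite big_cons.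
exact: cintegrableD.
Qed.

Lemma cintD r F P : 0 < r -> cintegrable r F -> cintegrable r P ->
  cint r (fun z => F z + P z) = cint r F + cint r P.
Proof.
move=> r0 [F1 F2] [P1 P2]; have mD := measurable_planar_disk r0.
rewrite /cint; simpc; congr (_ +i* _).
  by rewrite -RintegralD//; apply: eq_Rintegral => w _; rewrite ReD.
by rewrite -RintegralD//; apply: eq_Rintegral => w _; rewrite ImD.
Qed.

Lemma cintZ r F k : 0 < r -> cintegrable r F ->
  cint r (fun z => k * F z) = k * cint r F.
Proof.
move=> r0 [F1 F2]; have mD := measurable_planar_disk r0.
have iZ (a : R) (f : plane -> R) : mu2.-integrable (planar_disk r) (fun w => (f
  w)%:E) ->
    mu2.-integrable (planar_disk r) (fun w => (a * f w)%:E).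
  by move=> fi; apply: eq_integrable (integrableZl mD a fi).
rewrite /cint; case: k => a b; simpc; congr (_ +i* _).
- rewrite -!RintegralZl// -RintegralB//; [|exact: iZ..].
  by apply: eq_Rintegral => w _; rewrite ReM.
- rewrite -!RintegralZl// -RintegralD//; [|exact: iZ..].
  by apply: eq_Rintegral => w _; rewrite ImM.
Qed.

Lemma cint_sum r (I : Type) (s : seq I) (G : I -> R[i] -> R[i]) : 0 < r ->
  (forall i, cintegrable r (G i)) ->
  cint r (fun z => \sum_(i <- s) G i z) = \sum_(i <- s) cint r (G i).
Proof.
move=> r0 iG; elim: s => [|i s IH].
  rewrite big_nil (eq_cint r (P := fun=> 0)) => [|z]; last by rewrite big_nil.
  by rewrite /cint /Rintegral !integral0.
rewrite big_cons -IH -cintD//; last exact: cintegrable_sum.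
by apply: eq_cint => z; rewrite big_cons.
Qed.

Lemma measurable_mono a b :
  measurable_fun setT (fun w : plane => complex.Re (mono a b (cpt w))) /\
  measurable_fun setT (fun w : plane => complex.Im (mono a b (cpt w))).
Proof.
have m1 : measurable_fun setT (fun w : plane => w.1) by exact: measurable_fst.
have m2 : measurable_fun setT (fun w : plane => w.2) by exact: measurable_snd.
elim: a => [|a [IH1 IH2]].
  elim: b => [|b [IH1 IH2]].
    have E z : mono 0 0 z = 1 by rewrite /mono !expr0 mulr1.
    by split; under eq_fun do rewrite E; exact: measurable_cst.
  have E z : mono 0 b.+1 z = conjc z * mono 0 b z.
    by rewrite /mono exprS; ring.
  split.
  - under eq_fun do rewrite E ReM/=.
    by apply: measurable_funB; apply: measurable_funM => //;
      exact: measurable_funN.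
  - under eq_fun do rewrite E ImM/=.
    by apply: measurable_funD; apply: measurable_funM => //;
      exact: measurable_funN.
have E z : mono a.+1 b z = z * mono a b z by rewrite /mono exprS; ring.
split.
- under eq_fun do rewrite E ReM/=.
  by apply: measurable_funB; apply: measurable_funM.
- under eq_fun do rewrite E ImM/=.
  by apply: measurable_funD; apply: measurable_funM.
Qed.

Lemma planar_disk_finite r : 0 < r -> (mu2 (planar_disk r) < +oo)%E.
Proof. by move=> r0; rewrite area_planar_disk// ltry. Qed.

Lemma cintegrable_mono r a b : 0 < r -> cintegrable r (mono a b).
Proof.
move=> r0; have mD := measurable_planar_disk r0.
have [m1 m2] := measurable_mono a b.
have bnd (w : plane) : planar_disk r w -> normc (mono a b (cpt w)) <= r ^+ (a +
  b).
  by move=> wr; apply: mono_bound; exact: ltW.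
split; apply: measurable_bounded_integrable => //.
- exact: planar_disk_finite.
- exact: measurable_funTS.
- exists (r ^+ (a + b)); split; first exact: num_real.
  by move=> M rM w /bnd h; apply: (le_trans (Re_le_normc _));
    exact: le_trans (ltW rM).
- exact: planar_disk_finite.
- exact: measurable_funTS.
- exists (r ^+ (a + b)); split; first exact: num_real.
  by move=> M rM w /bnd h; apply: (le_trans (Im_le_normc _));
    exact: le_trans (ltW rM).
Qed.

(** This only serves to make the restrictions of F to horizontal and vertical
    lines continuous, as the fundamental theorem of calculus demands. *)
Definition csmooth F := forall w, exists p q : R[i], wirtinger F w p q.

Lemma csmooth_slices F : csmooth F ->
  [/\ forall y, continuous (fun x : R => complex.Re (F (x +i* y))),
      forall y, continuous (fun x : R => complex.Im (F (x +i* y))),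
      forall x, continuous (fun y : R => complex.Re (F (x +i* y))) &
      forall x, continuous (fun y : R => complex.Im (F (x +i* y)))].
Proof.
move=> sF.
have dc (f : R -> R) (x l : R) : is_derive x 1 f l -> {for x, continuous f}.
  by move=> [df _]; apply: differentiable_continuous; apply/derivable1_diffP.
by split => u v; [have := sF (v +i* u)|have := sF (v +i* u)|
  have := sF (u +i* v)|have := sF (u +i* v)];
  move=> [P [Q /wirtinger_derive /= [d1 d2 d3 d4]]];
  [exact: dc d1|exact: dc d2|exact: dc d3|exact: dc d4].
Qed.

Lemma csmoothB F P : csmooth F -> csmooth P -> csmooth (fun z => F z - P z).
Proof.
move=> sF sP w; have [? [? h1]] := sF w; have [? [? h2]] := sP w.
by do 2 eexists; exact: wirtingerB h1 h2.
Qed.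

Lemma csmoothZ F k : csmooth F -> csmooth (fun z => k * F z).
Proof.
by move=> sF w; have [? [? h1]] := sF w; do 2 eexists; exact: wirtingerZ h1.
Qed.

Lemma csmooth_mono a b : csmooth (mono a b).
Proof. by move=> w; do 2 eexists; exact: wirtinger_mono. Qed.

(** The partial derivatives of F are P + Q and i (P - Q); both integrate to
    zero, and P and Q are combinations of them. *)
Lemma cint_wirtinger0 r F P Q : 0 < r ->
  (forall w, wirtinger F w (P w) (Q w)) -> csmooth P -> csmooth Q ->
  cintegrable r P -> cintegrable r Q ->
  (forall z, normc z = r -> F z = 0) ->
  cint r P = 0 /\ cint r Q = 0.
Proof.
move=> r0 dF sP sQ iP iQ F0.
have F0' (x y : R) : x ^+ 2 + y ^+ 2 = r ^+ 2 -> F (x +i* y) = 0.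
  by move=> xy; apply: F0; rewrite /= xy sqrtr_sqr gtr0_norm.
pose S z := P z + Q z; pose T z := 'i%C * (P z - Q z).
have sS : csmooth S.
  have -> : S = (fun z => P z - (-1) * Q z) by apply/funext => z; rewrite /S;
    ring.
  by apply: csmoothB => //; exact: csmoothZ.
have sT : csmooth T by apply: csmoothZ; exact: csmoothB.
have iS : cintegrable r S by exact: cintegrableD.
have iT : cintegrable r T.
  apply: cintegrableZ => //.
  have -> : (fun z => P z - Q z) = (fun z => P z + (-1) * Q z).
    by apply/funext => z; ring.
  by apply: cintegrableD => //; exact: cintegrableZ.
have [cS1 cS2 _ _] := csmooth_slices sS.
have [_ _ cT1 cT2] := csmooth_slices sT.
have FRe x y : x ^+ 2 + y ^+ 2 = r ^+ 2 -> complex.Re (F (x +i* y)) = 0.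
  by move=> /F0' ->.
have FIm x y : x ^+ 2 + y ^+ 2 = r ^+ 2 -> complex.Im (F (x +i* y)) = 0.
  by move=> /F0' ->.
have D x y := wirtinger_derive (dF (x +i* y)).
have S0 : cint r S = 0.
  congr (_ +i* _).
    apply: (disk_integral_dx0 r0 iS.1 cS1 _ FRe) => x y.
    by have [] := D x y.
  apply: (disk_integral_dx0 r0 iS.2 cS2 _ FIm) => x y.
  by have [] := D x y.
have T0 : cint r T = 0.
  congr (_ +i* _).
    apply: (disk_integral_dy0 r0 iT.1 cT1 _ FRe) => x y.
    by have [] := D x y.
  apply: (disk_integral_dy0 r0 iT.2 cT2 _ FIm) => x y.
  by have [] := D x y.
have ii : 'i%C * 'i%C = -1 :> R[i] by rewrite -expr2 sqr_i.
split.
- rewrite (eq_cint r (P := fun z => 2^-1 * (S z + (- 'i%C) * T z))).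
    rewrite cintZ//; last by apply: cintegrableD => //; exact: cintegrableZ.
    rewrite cintD//; last exact: cintegrableZ.
    by rewrite cintZ// S0 T0 mulr0 addr0 mulr0.
  by move=> z; rewrite /S /T mulrA mulNr ii; field.
- rewrite (eq_cint r (P := fun z => 2^-1 * (S z + 'i%C * T z))).
    rewrite cintZ//; last by apply: cintegrableD => //; exact: cintegrableZ.
    rewrite cintD//; last exact: cintegrableZ.
    by rewrite cintZ// S0 T0 mulr0 addr0 mulr0.
  by move=> z; rewrite /S /T mulrA ii; field.
Qed.

Lemma mono_zE a b : @mono_z R a b = (fun z => a%:R * mono a.-1 b z).
Proof. by apply/funext => z; rewrite /mono_z /mono mulrA. Qed.

Lemma mono_zbarE a b : @mono_zbar R a b = (fun z => b%:R * mono a b.-1 z).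
Proof. by apply/funext => z; rewrite /mono_zbar /mono mulrA. Qed.

(** The two Wirtinger derivatives of (r^2 - |z|^2) z^a conj(z)^b integrate to
    zero. *)
Lemma moment_rec r a b : 0 < r ->
  a.+1%:R * cint r (mono a b.+1) = a%:R * (r ^+ 2)%:C * cint r (mono a.-1 b) /\
  b.+1%:R * cint r (mono a.+1 b) = b%:R * (r ^+ 2)%:C * cint r (mono a b.-1).
Proof.
move=> r0; pose k := (r ^+ 2)%:C.
pose F z := k * mono a b z - mono a.+1 b.+1 z.
have iZ (j : R[i]) c d : cintegrable r (fun z => j * mono c d z).
  by apply: cintegrableZ => //; exact: cintegrable_mono.
have sZ (j : R[i]) c d : csmooth (fun z => j * mono c d z).
  by apply: csmoothZ; exact: csmooth_mono.
have dF w : wirtinger F w (k * mono_z a b w - mono_z a.+1 b.+1 w)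
    (k * mono_zbar a b w - mono_zbar a.+1 b.+1 w).
  apply: wirtingerB; last exact: wirtinger_mono.
  by apply: wirtingerZ; exact: wirtinger_mono.
have E (c d c' d' : nat) (i j : nat) :
    (fun z => k * (i%:R * mono c d z) - j%:R * mono c' d' z) =
    (fun z => (k * i%:R) * mono c d z + (- j%:R) * mono c' d' z).
  by apply/funext => z; rewrite mulrA mulNr.
have [//|||||] := cint_wirtinger0 r0 dF.
- rewrite !mono_zE; apply: csmoothB => //.
  by apply: csmoothZ; exact: sZ.
- rewrite !mono_zbarE; apply: csmoothB => //.
  by apply: csmoothZ; exact: sZ.
- by rewrite !mono_zE E; apply: cintegrableD.
- by rewrite !mono_zbarE E; apply: cintegrableD.
- move=> z zr; rewrite /F.
  have -> : mono a.+1 b.+1 z = z * conjc z * mono a b z.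
    by rewrite /mono !exprS; ring.
  by rewrite mulcJ zr subrr.
rewrite !mono_zE !mono_zbarE !E !cintD// !cintZ//; try exact: cintegrable_mono.
rewrite !mulNr => /eqP + /eqP; rewrite !subr_eq0 => /eqP e1 /eqP e2.
by rewrite -e1 -e2 ![k * _]mulrC.
Qed.

Lemma moment r a b : 0 < r -> cint r (mono a b) =
  if a == b then (pi * r ^+ (2 * a.+1) / a.+1%:R)%:C else 0.
Proof.
move=> r0; have n0 n : (n.+1%:R : R[i]) != 0 by rewrite pnatr_eq0.
elim: a b => [|a IH] [|b].
- rewrite eqxx (eq_cint r (P := fun=> 1)) => [|z];
    last by rewrite /mono !expr0 mulr1.
  rewrite /cint !Rintegral_cst/= ?area_planar_disk//=;
    try exact: measurable_planar_disk.
  by rewrite mul0r mul1r divr1 muln1.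
- by have [+ _] := moment_rec 0 b r0; rewrite !mul0r mul1r.
- by have [_] := moment_rec a 0 r0; rewrite !mul0r mul1r.
have [+ _] := moment_rec a.+1 b r0; rewrite /= IH eqSS.
move=> e; apply: (mulfI (n0 a.+1)); rewrite e; case: eqP => _;
  last by rewrite !mulr0.
rewrite -!(rmorph_nat (real_complex R)) -!rmorphM/=; congr (_%:C).
rewrite [(2 * a.+2)%N]mulnS exprD.
by field; rewrite !gt_eqF// ltr_pwDl.
Qed.

End Moments.

(** * The area of a polynomial map *)

Section TruncatedArea.
Variable R : realType.
Implicit Types (r : R).

Local Notation mu := (@lebesgue_measure R).
Local Notation mu2 := (mu \x mu)%E.
Local Notation cpt w := (w.1 +i* w.2).

(** The polarized Jacobian of two monomials is a multiple of a single
    monomial, with coefficient a a' - b b'. Its moment is nonzero only when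
    the frequencies a - b and a' - b' agree, and then a a' - b b' = (a - b) (a
    + b'), which cancels the denominator a + b' of the moment. *)
Lemma cint_jacobian_mono r a b a' b' : 0 < r ->
  cint r (fun z => mono_z a b z * conjc (mono_z a' b' z)
                 - mono_zbar a b z * conjc (mono_zbar a' b' z)) =
  if (a + b' == b + a')%N
  then ((a%:R - b%:R) * (pi * r ^+ (2 * (a + b'))))%:C else 0.
Proof.
move=> r0.
have E (z : R[i]) : mono_z a b z * conjc (mono_z a' b' z)
         - mono_zbar a b z * conjc (mono_zbar a' b' z) =
   (a * a')%:R * mono (a.-1 + b') (b + a'.-1) z +
   (- (b * b')%:R) * mono (a + b'.-1) (b.-1 + a') z.
  rewrite /mono_z /mono_zbar /mono !rmorphM !rmorphXn !rmorph_nat /= !conjcK.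
  by rewrite ?natrM !exprD; ring.
rewrite (eq_cint r E) cintD//; last 2 first.
- by apply: cintegrableZ => //; exact: cintegrable_mono.
- by apply: cintegrableZ => //; exact: cintegrable_mono.
rewrite !cintZ//; try exact: cintegrable_mono.
rewrite !moment//.
(* With a + b' = 0 both coefficients vanish, and so does a - b when the
   frequencies agree. *)
have [ab0|ab0] := posnP (a + b').
  move/eqP: ab0; rewrite addn_eq0 => /andP[/eqP -> /eqP ->].
  rewrite mul0n muln0 oppr0 !mul0r addr0.
  by case: eqP => // /esym/eqP; rewrite addn_eq0 => /andP[/eqP -> _];
    rewrite subrr mul0r.
have E1 : (a * a')%:R * (if (a.-1 + b' == b + a'.-1)%N then
      (pi * r ^+ (2 * (a.-1 + b').+1) / (a.-1 + b').+1%:R)%:C else 0) =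
    if (a + b' == b + a')%N then
      (((a * a')%:R / (a + b')%:R) * (pi * r ^+ (2 * (a + b'))))%:C else 0 :>
        R[i].
  case: (posnP a) => [->|a0]; first by rewrite mul0n !mul0r; case: ifP.
  case: (posnP a') => [->|a'0]; first by rewrite muln0 !mul0r; case: ifP.
  rewrite -addSn prednK// -(eqn_add2r 1) !addn1 -addSn prednK// -addnS prednK//.
  case: ifP => _; last by rewrite mulr0.
  by rewrite -(rmorph_nat (real_complex R)) -rmorphM; congr (_%:C); ring.
have E2 : - (b * b')%:R * (if (a + b'.-1 == b.-1 + a')%N then
      (pi * r ^+ (2 * (a + b'.-1).+1) / (a + b'.-1).+1%:R)%:C else 0) =
    if (a + b' == b + a')%N then
      (- ((b * b')%:R / (a + b')%:R) * (pi * r ^+ (2 * (a + b'))))%:C else 0 :>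
        R[i].
  case: (posnP b) => [->|b0]; first by rewrite mul0n oppr0 !mul0r oppr0 mul0r;
    case: ifP.
  case: (posnP b') => [->|b'0];
    first by rewrite muln0 oppr0 !mul0r oppr0 mul0r; case: ifP.
  rewrite -addnS prednK// -(eqn_add2r 1) !addn1 -addnS prednK// -addSn prednK//.
  case: ifP => _; last by rewrite mulr0.
  rewrite -(rmorph_nat (real_complex R)) -rmorphN -rmorphM; congr (_%:C); ring.
rewrite E1 E2; case: eqP => [e|_]; last by rewrite addr0.
rewrite -rmorphD -mulrDl; congr (_ * _)%:C.
have n0 : (a + b')%:R != 0 :> R by rewrite pnatr_eq0 -lt0n.
rewrite -mulrBl; apply: (mulIf n0); rewrite divfK//.
rewrite !natrM.
have -> : a'%:R = a%:R + b'%:R - b%:R :> R by rewrite -natrD e natrD addrC addKr.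
by rewrite natrD; ring.
Qed.

Lemma cintegrable_jacobian_mono r a b a' b' : 0 < r ->
  cintegrable r (fun z => mono_z a b z * conjc (mono_z a' b' z)
                 - mono_zbar a b z * conjc (mono_zbar a' b' z)).
Proof.
move=> r0.
have -> : (fun z : R[i] => mono_z a b z * conjc (mono_z a' b' z)
         - mono_zbar a b z * conjc (mono_zbar a' b' z)) =
   (fun z : R[i] => (a * a')%:R * mono (a.-1 + b') (b + a'.-1) z +
   (- (b * b')%:R) * mono (a + b'.-1) (b.-1 + a') z).
  apply/funext => z.
  rewrite /mono_z /mono_zbar /mono !rmorphM !rmorphXn !rmorph_nat /= !conjcK.
  by rewrite ?natrM !exprD; ring.
by apply: cintegrableD => //; apply: cintegrableZ => //; exact: cintegrable_mono.
Qed.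

Section Sums.
Variables (I : finType) (c : I -> R[i]) (a b : I -> nat).

Let P z := \sum_i c i * mono_z (a i) (b i) z.
Let Q z := \sum_i c i * mono_zbar (a i) (b i) z.

Let jacE z : P z * conjc (P z) - Q z * conjc (Q z) = \sum_i \sum_k
  c i * conjc (c k) * (mono_z (a i) (b i) z * conjc (mono_z (a k) (b k) z)
     - mono_zbar (a i) (b i) z * conjc (mono_zbar (a k) (b k) z)).
Proof.
rewrite /P /Q !rmorph_sum !mulr_suml -sumrB; apply: eq_bigr => i _.
rewrite !mulr_sumr -sumrB; apply: eq_bigr => k _.
by rewrite !rmorphM; ring.
Qed.

Lemma integral_jacobian_sum r : 0 < r ->
  mu2.-integrable (planar_disk r)
    (fun w => (normc (P (cpt w)) ^+ 2 - normc (Q (cpt w)) ^+ 2)%:E) /\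
  \int[mu2]_(w in planar_disk r)
      (normc (P (cpt w)) ^+ 2 - normc (Q (cpt w)) ^+ 2) =
  \sum_i \sum_k if (a i + b k == b i + a k)%N then
     complex.Re (c i * conjc (c k)) *
       (((a i)%:R - (b i)%:R) * (pi * r ^+ (2 * (a i + b k)))) else 0.
Proof.
move=> r0.
have RE z : normc (P z) ^+ 2 - normc (Q z) ^+ 2 =
    complex.Re (P z * conjc (P z) - Q z * conjc (Q z)).
  by rewrite ReD ReN !mulcJ.
have iS : cintegrable r (fun z => P z * conjc (P z) - Q z * conjc (Q z)).
  rewrite (funext jacE); do 2 (apply: cintegrable_sum => // ?).
  by apply: cintegrableZ => //; exact: cintegrable_jacobian_mono.
under [X in _ /\ X = _]eq_Rintegral do rewrite RE.
split; first by under eq_fun do rewrite RE; exact: iS.1.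
transitivity (complex.Re (cint r (fun z => P z * conjc (P z) - Q z * conjc (Q
  z)))).
  by [].
rewrite (eq_cint r jacE) cint_sum//; last first.
  move=> i; apply: cintegrable_sum => // k.
  by apply: cintegrableZ => //; exact: cintegrable_jacobian_mono.
rewrite Re_sum; apply: eq_bigr => i _.
rewrite cint_sum//; last first.
  by move=> k; apply: cintegrableZ => //; exact: cintegrable_jacobian_mono.
rewrite Re_sum; apply: eq_bigr => k _.
rewrite cintZ//; last exact: cintegrable_jacobian_mono.
rewrite cint_jacobian_mono//; case: ifP => _; last by rewrite mulr0.
by rewrite [LHS]ReM/= mulr0 subr0.
Qed.

End Sums.

Section Truncation.
Variables (p : nat) (a b : nat -> nat -> R[i]).

(** Indices start at 0: n stands for the power n of |z|^2, and j for the
    frequency j + 1. *)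
Definition trunc_dz N z := \sum_(j < N) \sum_(n < p)
  (a n j * mono_z (j.+1 + n) n z + conjc (b n j) * mono_z n (j.+1 + n) z).

Definition trunc_dzbar N z := \sum_(j < N) \sum_(n < p)
  (a n j * mono_zbar (j.+1 + n) n z + conjc (b n j) * mono_zbar n (j.+1 + n) z).

(** The contribution of frequency j + 1 to the normalized area, expanded in
    powers of r: it is (j + 1) (|A|^2 - |B|^2) for A = sum_n a_n r^(j+1+2n)
    and B the analogous sum of the b_n. *)
Definition area_term r j := \sum_(n < p) \sum_(k < p)
  complex.Re (a n j * conjc (a k j) - b n j * conjc (b k j)) *
  (j.+1%:R * r ^+ (2 * (j.+1 + n + k))).

(** A holomorphic term has frequency j + 1 and an antiholomorphic one has
    frequency -(j + 1), so that only pairs of terms of the same kind and the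
    same j interact. *)
Lemma area_truncated r N : 0 < r ->
  mu2.-integrable (planar_disk r)
    (fun w => (normc (trunc_dz N (cpt w)) ^+ 2 - normc (trunc_dzbar N (cpt w))
      ^+ 2)%:E) /\
  \int[mu2]_(w in planar_disk r)
      (normc (trunc_dz N (cpt w)) ^+ 2 - normc (trunc_dzbar N (cpt w)) ^+ 2) =
  pi * \sum_(j < N) area_term r j.
Proof.
move=> r0.
pose I : finType := ('I_N * 'I_p * bool)%type.
pose c (i : I) := if i.2 then a i.1.2 i.1.1 else conjc (b i.1.2 i.1.1).
pose e (i : I) := if i.2 then (i.1.1.+1 + i.1.2)%N else i.1.2 : nat.
pose e' (i : I) := if i.2 then i.1.2 : nat else (i.1.1.+1 + i.1.2)%N.
have sumI (V : zmodType) (f : I -> V) : \sum_i f i =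
    \sum_(j < N) \sum_(n < p) (f (j, n, true) + f (j, n, false)).
  rewrite pair_bigA/= (eq_bigr (fun i : 'I_N * 'I_p => \sum_s f (i, s)));
    last first.
    by move=> [j n] _; rewrite big_bool.
  by rewrite pair_bigA/=; apply: eq_bigr => -[[]].
have -> : trunc_dz N = fun z => \sum_i c i * mono_z (e i) (e' i) z.
  by apply/funext => z; rewrite sumI.
have -> : trunc_dzbar N = fun z => \sum_i c i * mono_zbar (e i) (e' i) z.
  by apply/funext => z; rewrite sumI.
have [? ->] := integral_jacobian_sum c e e' r0; split => //.
rewrite sumI mulr_sumr; apply: eq_bigr => j _.
rewrite /area_term mulr_sumr; apply: eq_bigr => n _.
rewrite !sumI -big_split/= (bigD1 j)//= [X in _ + X]big1 => [|j' j'j]; last first.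
  have {}j'j : nat_of_ord j' <> j by move=> /val_inj /eqP; apply/negP.
  rewrite -big_split big1// => k _ /=; rewrite /e /e'/=.
  rewrite !ifF ?addr0//; apply/negP => /eqP/= h.
  - by move: h; lia.
  - by move: h; lia.
  - by move: h; lia.
  - by move: h; lia.
rewrite addr0 mulr_sumr -big_split; apply: eq_bigr => k _ /=; rewrite /e /e' /c/=.
rewrite ifT; last by apply/eqP; lia.
rewrite ifF; last by apply/negP => /eqP; lia.
rewrite ifF; last by apply/negP => /eqP; lia.
rewrite ifT; last by apply/eqP; lia.
rewrite addr0 add0r ReD ReN.
have -> : complex.Re (conjc (b n j) * conjc (conjc (b k j))) =
  complex.Re (b n j * conjc (b k j)).
  by rewrite conjcK !ReM !ReJ !ImJ; ring.
have -> : (n + (j.+1 + k) = j.+1 + n + k)%N by lia.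
by rewrite !natrD; ring.
Qed.

End Truncation.
End TruncatedArea.

(** * Limits of complex sequences *)

Section ComplexLimits.
Variable R : realType.
Implicit Types (u v : nat -> R[i]) (k l : R[i]).

(** Componentwise, so that limits of complex sequences are governed by the
    theory of real ones. *)
Definition ccvg u l :=
  (fun N => complex.Re (u N)) @ \oo --> complex.Re l /\
  (fun N => complex.Im (u N)) @ \oo --> complex.Im l.

Lemma ccvg_cvg u l : (u : nat -> R[i]^o) @ \oo --> (l : R[i]^o) -> ccvg u l.
Proof.
move/cvgrPdist_lt => ul.
have H (e : R) : 0 < e -> \forall N \near \oo, normc (l - u N) < e.
  move=> e0; have := ul e%:C; rewrite ltcR => /(_ e0).
  by apply: filterS => N; rewrite -ltcR.
split; apply/cvgrPdist_lt => e /H; apply: filterS => N; apply: le_lt_trans.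
  by rewrite -ReN -ReD Re_le_normc.
by rewrite -ImN -ImD Im_le_normc.
Qed.

Lemma ccvgD u v k l : ccvg u k -> ccvg v l -> ccvg (fun N => u N + v N) (k + l).
Proof.
move=> [u1 u2] [v1 v2]; split; [rewrite ReD|rewrite ImD].
  by under eq_fun do rewrite ReD; exact: cvgD.
by under eq_fun do rewrite ImD; exact: cvgD.
Qed.

Lemma ccvgM u v k l : ccvg u k -> ccvg v l -> ccvg (fun N => u N * v N) (k * l).
Proof.
move=> [u1 u2] [v1 v2]; split; [rewrite ReM|rewrite ImM].
  by under eq_fun do rewrite ReM; apply: cvgB; exact: cvgM.
by under eq_fun do rewrite ImM; apply: cvgD; exact: cvgM.
Qed.

Lemma ccvg_cst k : ccvg (fun=> k) k.
Proof. by split; exact: cvg_cst. Qed.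

Lemma ccvgN u l : ccvg u l -> ccvg (fun N => - u N) (- l).
Proof.
by rewrite -mulN1r (funext (fun N => esym (mulN1r (u N)))); apply: ccvgM;
  exact: ccvg_cst.
Qed.

Lemma ccvgJ u l : ccvg u l -> ccvg (fun N => conjc (u N)) (conjc l).
Proof.
move=> [u1 u2]; split; [rewrite ReJ|rewrite ImJ].
  by under eq_fun do rewrite ReJ.
by under eq_fun do rewrite ImJ; exact: cvgN.
Qed.

Lemma ccvg_sum (I : Type) (s : seq I) (u : I -> nat -> R[i]) (l : I -> R[i]) :
  (forall i, ccvg (u i) (l i)) ->
  ccvg (fun N => \sum_(i <- s) u i N) (\sum_(i <- s) l i).
Proof.
move=> ul; elim: s => [|i s IH].
  by rewrite big_nil; under eq_fun do rewrite big_nil; exact: ccvg_cst.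
by rewrite big_cons; under eq_fun do rewrite big_cons; exact: ccvgD.
Qed.

Lemma ccvg_normc_sqr u l : ccvg u l ->
  (fun N => normc (u N) ^+ 2) @ \oo --> normc l ^+ 2.
Proof.
move=> [u1 u2]; rewrite normc_sqr; under eq_fun do rewrite normc_sqr.
by apply: cvgD; rewrite expr2; under eq_fun do rewrite expr2; exact: cvgM.
Qed.

Lemma ccvg_normc_le u l (C : R) : ccvg u l -> (forall N, normc (u N) <= C) ->
  normc l <= C.
Proof.
move=> /ccvg_normc_sqr ul uC.
have C0 : 0 <= C by exact: le_trans (normc_ge0 _) (uC 0%N).
rewrite -(@ler_pXn2r _ 2)// ?nnegrE ?normc_ge0//.
apply: (cvgr_to_le ul); apply: nearW => N.
by rewrite ler_pXn2r// ?nnegrE ?normc_ge0.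
Qed.

Lemma ccvg_series_summable u (C : R) :
  (forall N, \sum_(j < N) normc (u j) <= C) ->
  exists l, ccvg (fun N => \sum_(j < N) u j) l.
Proof.
move=> uC.
have H (f : nat -> R) : (forall j, `|f j| <= normc (u j)) ->
    cvgn (fun N => \sum_(j < N) f j).
  move=> fu; have -> : (fun N => \sum_(j < N) f j) = series f.
    by apply/funext => N; rewrite /series/= big_mkord.
  apply: normed_cvg; apply: nondecreasing_is_cvgn.
    by apply/nondecreasing_series => n _ _; exact: normr_ge0.
  exists C => _ [N _ <-]; rewrite /= seriesEord.
  by apply: (le_trans _ (uC N)); apply: ler_sum.
have /cvg_ex[x ux] := H _ (fun j => Re_le_normc (u j)).
have /cvg_ex[y uy] := H _ (fun j => Im_le_normc (u j)).
exists (x +i* y); split => /=.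
  by under eq_fun do rewrite Re_sum.
by under eq_fun do rewrite Im_sum.
Qed.

End ComplexLimits.

(** * Summability of power series coefficients *)

Section PowerSeries.
Variable R : realType.

(** The terms are differences of consecutive partial sums, which converge at
    the point s. *)
Lemma power_series_terms_bounded (c : nat -> R[i]) h (s : R) :
  power_series_sum c h -> 0 < s < 1 ->
  exists2 M : R, 0 <= M & forall j, normc (c j.+1) * s ^+ j.+1 <= M.
Proof.
move=> ch /andP[s0 s1].
have ds : disk 1 s%:C by rewrite /disk /= expr0n addr0 sqrtr_sqr gtr0_norm.
have [u1 u2] := ccvg_cvg (ch _ ds).
pose T N : R[i] := \sum_(1 <= j < N.+1) c j * s%:C ^+ j.
have bd (f : nat -> R) (l : R) : f @ \oo --> l -> exists2 K, 0 <= K & forall N,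
  `|f N| <= K.
  move=> fl; have [M [Mr fM]] := cvg_seq_bounded (cvgP _ fl).
  exists (`|M| + 1) => [|N]; first by rewrite addr_ge0.
  by apply: fM => //; rewrite (le_lt_trans (ler_norm _))// ltrDl.
have [K1 K10 b1] := bd _ _ u1; have [K2 K20 b2] := bd _ _ u2.
have TK N : normc (T N) <= K1 + K2.
  apply: (le_trans (normc_le_ReIm _)).
  by apply: lerD; [exact: b1|exact: b2].
exists ((K1 + K2) + (K1 + K2)) => [|j]; first by rewrite !addr_ge0.
have -> : normc (c j.+1) * s ^+ j.+1 = normc (T j.+1 - T j).
  rewrite /T [X in X - _]big_nat_recr//= addrAC subrr add0r normcM normcX normcR.
  by rewrite gtr0_norm.
by apply: (le_trans (le_normcD _ _)); rewrite normcN lerD.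
Qed.

Lemma sum_geometric_le (x : R) N : 0 <= x < 1 -> \sum_(j < N) x ^+ j <= (1 -
  x)^-1.
Proof.
move=> /andP[x0 x1]; have y0 : 0 < 1 - x by rewrite subr_gt0.
rewrite -[leRHS]mul1r ler_pdivlMr// mulrC.
have := subrX1 x N; rewrite -(opprB 1 x) mulNr => /eqP.
rewrite -eqr_oppLR opprB => /eqP <-.
by rewrite lerBlDr lerDl exprn_ge0.
Qed.

(** The coefficients are bounded by a multiple of (s^3 rho)^(-j) for some s >
    1 with s^3 rho < 1. Two of the three factors s^k absorb k^2, by the
    inequality k (s - 1) <= s^k, and the third leaves a geometric series. *)
Lemma power_series_summable (c : nat -> R[i]) h (rho : R) (d : nat) :
  power_series_sum c h -> 0 < rho < 1 ->
  exists C, forall N,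
    \sum_(j < N) normc (c j.+1) * ((j.+1 + d)%:R ^+ 2 * rho ^+ (j.+1 + d)) <= C.
Proof.
move=> ch /andP[r0 r1].
(* As e <= 1/8, the cube of 1 + e is at most 1 + 4 e = 1 + (1 - rho)/2. *)
pose e := (1 - rho) / 8; pose s := 1 + e.
have e0 : 0 < e by rewrite divr_gt0// subr_gt0.
have s0 : 0 < s by rewrite addr_gt0.
have s1 : 1 < s by rewrite ltrDl.
have [e0' s0' r0' s1'] := And4 (ltW e0) (ltW s0) (ltW r0) (ltW s1).
have sr : s ^+ 3 * rho < 1.
  have e1 : e < 1 / 8 by rewrite ltr_pM2r ?invr_gt0// gtrBl.
  have s3 : s ^+ 3 <= 1 + 4 * e by rewrite /s; nra.
  apply: (@le_lt_trans _ _ ((1 + 4 * e) * rho)); first by rewrite ler_pM2r.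
  by rewrite /e; nra.
clearbody e.
have [M M0 cM] := power_series_terms_bounded ch (introT andP
  (conj (mulr_gt0 (exprn_gt0 3 s0) r0) sr)).
pose x := s^-1.
have x01 : 0 <= x < 1 by rewrite invr_ge0 ltW//= invf_lt1.
exists (M / e ^+ 2 * (1 - x)^-1) => N.
have k0 : 0 <= M / e ^+ 2 by rewrite divr_ge0// exprn_ge0// ltW.
apply: le_trans (ler_wpM2l k0 (sum_geometric_le N x01)).
rewrite mulr_sumr; apply: ler_sum => j _.
set k := (j.+1 + d)%N.
have ks : k%:R * e <= s ^+ k.
  elim: k => [|k IH]; first by rewrite mul0r expr0.
  rewrite -natr1 mulrDl mul1r exprS /s mulrDl mul1r -/s; apply: lerD => //.
  by rewrite ler_peMr ?exprn_ege1// ltW.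
have k2 : k%:R ^+ 2 <= s ^+ k ^+ 2 / e ^+ 2.
  by rewrite ler_pdivlMr ?exprn_gt0// -exprMn lerXn2r// ?nnegrE ?exprn_ge0
    ?mulr_ge0//.
have s2r : s ^+ 2 * rho <= 1.
  by apply: le_trans (ltW sr); rewrite ler_pM2r// (exprS s 2) ler_peMl ?exprn_ge0.
apply: (@le_trans _ _ (normc (c j.+1) * ((s ^+ k ^+ 2 / e ^+ 2) * rho ^+ k))).
  by rewrite ler_wpM2l ?normc_ge0// ler_wpM2r// exprn_ge0.
have -> : normc (c j.+1) * ((s ^+ k ^+ 2 / e ^+ 2) * rho ^+ k) =
  normc (c j.+1) * (s ^+ 2 * rho) ^+ k / e ^+ 2.
  by rewrite exprMn -!exprM mulnC; ring.
rewrite [leRHS]mulrAC ler_wpM2r ?invr_ge0 ?exprn_ge0 ?(ltW e0)//.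
apply: (@le_trans _ _ (normc (c j.+1) * (s ^+ 2 * rho) ^+ j.+1)).
  rewrite ler_wpM2l ?normc_ge0// /k exprD ler_piMr ?exprn_ile1 ?exprn_ge0//;
    by rewrite mulr_ge0 ?exprn_ge0.
have -> : s ^+ 2 * rho = s ^+ 3 * rho * x.
  by rewrite /x exprSr; field; rewrite gt_eqF.
rewrite exprMn mulrA; apply: ler_pM => //.
- by rewrite mulr_ge0 ?normc_ge0// exprn_ge0// mulr_ge0 ?exprn_ge0.
- by rewrite exprn_ge0//; case/andP: x01.
- by case/andP: x01 => x0 x1; rewrite exprS ler_piMl ?exprn_ge0// ltW.
Qed.

End PowerSeries.

(** * Passage to the limit in the Jacobian *)

Section TruncationLimit.
Variable R : realType.
Variables (p : nat) (a b : nat -> nat -> R[i]) (F : R[i] -> R[i]).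

Local Notation mu := (@lebesgue_measure R).
Local Notation mu2 := (mu \x mu)%E.
Local Notation cpt w := (w.1 +i* w.2).

Definition trunc N z := \sum_(j < N) \sum_(n < p)
  (a n j * mono (j.+1 + n) n z + conjc (b n j) * mono n (j.+1 + n) z).

(** The contribution of one pair of coefficients to the bound of
    [mono_taylor]; since k <= k^2, it also dominates rho times their
    contribution to the derivatives. *)
Definition weight (rho : R) j n : R :=
  (normc (a n j) + normc (b n j)) *
    ((j.+1 + n + n)%:R ^+ 2 * rho ^+ (j.+1 + n + n)).

Hypothesis trunc_cvg : forall z, disk 1 z -> ccvg (trunc ^~ z) (F z).
Hypothesis summable : forall rho : R, 0 < rho < 1 ->
  exists C, forall N, \sum_(j < N) \sum_(n < p) weight rho j n <= C.

Let dz_term z j := \sum_(n < p)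
  (a n j * mono_z (j.+1 + n) n z + conjc (b n j) * mono_z n (j.+1 + n) z).
Let dzbar_term z j := \sum_(n < p)
  (a n j * mono_zbar (j.+1 + n) n z + conjc (b n j) * mono_zbar n (j.+1 + n) z).

Lemma derivative_term_bound (rho : R) z j : 0 < rho -> normc z <= rho ->
  rho * normc (dz_term z j) <= \sum_(n < p) weight rho j n /\
  rho * normc (dzbar_term z j) <= \sum_(n < p) weight rho j n.
Proof.
move=> r0 zr.
have key (k m : nat) (c : R[i]) (y : R) : (m <= k)%N -> y <= m%:R * rho ^+ k ->
    normc c * y <= normc c * (k%:R ^+ 2 * rho ^+ k).
  move=> mk ym; rewrite ler_wpM2l ?normc_ge0//; apply: (le_trans ym).
  rewrite ler_wpM2r ?exprn_ge0 ?(ltW r0)// -natrX ler_nat.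
  by rewrite -mulnn; nia.
split; apply: (le_trans (ler_wpM2l (ltW r0) (normc_sum _ _ _)));
  rewrite mulr_sumr; apply: ler_sum => n _;
  apply: (le_trans (ler_wpM2l (ltW r0) (le_normcD _ _)));
  rewrite mulrDr (normcM (a n j)) (normcM (conjc (b n j))) normcJ;
  rewrite ![rho * (normc _ * _)]mulrCA /weight mulrDl; apply: lerD.
- apply: key (mono_z_bound _ _ zr); lia.
- rewrite [X in X%:R](_ : _ = n + (j.+1 + n))%N; last by rewrite addnC.
  rewrite [in rho ^+ _](_ : (j.+1 + n + n) = n + (j.+1 + n))%N;
    last by rewrite addnC.
  apply: key (mono_z_bound _ _ zr); lia.
- apply: key (mono_zbar_bound _ _ zr); lia.
- rewrite [X in X%:R](_ : _ = n + (j.+1 + n))%N; last by rewrite addnC.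
  rewrite [in rho ^+ _](_ : (j.+1 + n + n) = n + (j.+1 + n))%N;
    last by rewrite addnC.
  apply: key (mono_zbar_bound _ _ zr); lia.
Qed.

Lemma trunc_derivatives_bound (rho C : R) z N : 0 < rho -> normc z <= rho ->
  (forall N, \sum_(j < N) \sum_(n < p) weight rho j n <= C) ->
  normc (trunc_dz p a b N z) <= C / rho /\
  normc (trunc_dzbar p a b N z) <= C / rho.
Proof.
move=> r0 zr hC.
by split; rewrite ler_pdivlMr// mulrC;
  apply: (le_trans (ler_wpM2l (ltW r0) (normc_sum _ _ _)));
  rewrite mulr_sumr; apply: (le_trans _ (hC N)); apply: ler_sum => j _;
  have [h1 h2] := derivative_term_bound j r0 zr.
Qed.

Lemma trunc_derivatives_cvg z : disk 1 z -> exists P Q : R[i],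
  ccvg (fun N => trunc_dz p a b N z) P /\ ccvg (fun N => trunc_dzbar p a b N z) Q.
Proof.
rewrite /disk/= => z1; pose rho := (1 + normc z) / 2.
have z0 := normc_ge0 z.
have r01 : 0 < rho < 1 by rewrite /rho; apply/andP; split; lra.
have zr : normc z <= rho by rewrite /rho; lra.
have [r0 _] := andP r01; have [C hC] := summable r01.
have [P hP] : exists P, ccvg (fun N => \sum_(j < N) dz_term z j) P.
  apply: (ccvg_series_summable (C := C / rho)) => N.
  rewrite ler_pdivlMr// mulrC mulr_sumr; apply: (le_trans _ (hC N)).
  by apply: ler_sum => j _; have [] := derivative_term_bound j r0 zr.
have [Q hQ] : exists Q, ccvg (fun N => \sum_(j < N) dzbar_term z j) Q.
  apply: (ccvg_series_summable (C := C / rho)) => N.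
  rewrite ler_pdivlMr// mulrC mulr_sumr; apply: (le_trans _ (hC N)).
  by apply: ler_sum => j _; have [] := derivative_term_bound j r0 zr.
by exists P, Q.
Qed.

Lemma trunc_taylor (rho C : R) z w N : 0 < rho ->
  normc z <= rho -> normc w <= rho ->
  (forall N, \sum_(j < N) \sum_(n < p) weight rho j n <= C) ->
  normc (trunc N z - trunc N w - (trunc_dz p a b N w * (z - w)
     + trunc_dzbar p a b N w * conjc (z - w))) <=
  C / rho ^+ 2 * normc (z - w) ^+ 2.
Proof.
move=> r0 zr wr hC.
rewrite [leRHS]mulrAC ler_pdivlMr ?exprn_gt0// mulrC.
pose rem k m := mono k m z - mono k m w -
  (mono_z k m w * (z - w) + mono_zbar k m w * conjc (z - w)).
have -> : trunc N z - trunc N w - (trunc_dz p a b N w * (z - w)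
     + trunc_dzbar p a b N w * conjc (z - w)) =
  \sum_(j < N) \sum_(n < p)
    (a n j * rem (j.+1 + n)%N n + conjc (b n j) * rem n (j.+1 + n)%N).
  rewrite /trunc /trunc_dz /trunc_dzbar !mulr_suml -big_split -!sumrB.
  apply: eq_bigr => j _; rewrite !mulr_suml -big_split -!sumrB.
  by apply: eq_bigr => n _; rewrite /rem /=; ring.
apply: (le_trans (ler_wpM2l (sqr_ge0 _) (normc_sum _ _ _))).
apply: (@le_trans _ _ ((\sum_(j < N) \sum_(n < p) weight rho j n) * normc (z -
  w) ^+ 2)); last first.
  by rewrite ler_wpM2r ?sqr_ge0.
rewrite mulr_sumr mulr_suml; apply: ler_sum => j _.
apply: (le_trans (ler_wpM2l (sqr_ge0 _) (normc_sum _ _ _))).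
rewrite mulr_sumr mulr_suml; apply: ler_sum => n _.
apply: (le_trans (ler_wpM2l (sqr_ge0 _) (le_normcD _ _))).
rewrite mulrDr (normcM (a n j)) (normcM (conjc (b n j))) normcJ.
rewrite ![rho ^+ 2 * (normc _ * _)]mulrCA /weight -[leRHS]mulrA [leRHS]mulrDl.
apply: lerD.
  by rewrite ler_wpM2l ?normc_ge0//; exact: mono_taylor (ltW r0) zr wr.
rewrite ler_wpM2l ?normc_ge0//.
by have := mono_taylor n (j.+1 + n) (ltW r0) zr wr; rewrite (addnC n).
Qed.

(** The Taylor estimate of the truncations on the disk of radius rho has a
    constant that does not depend on the truncation, hence it holds in the
    limit. *)
Lemma limit_wirtinger w P Q : disk 1 w ->
  ccvg (fun N => trunc_dz p a b N w) P -> ccvg (fun N => trunc_dzbar p a b N w)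
    Q ->
  wirtinger F w P Q.
Proof.
move=> w1' hP hQ; have w1 : normc w < 1 by [].
have w0 := normc_ge0 w.
pose rho := (1 + normc w) / 2.
have r01 : 0 < rho < 1 by rewrite /rho; apply/andP; split; lra.
have wr : normc w <= rho by rewrite /rho; lra.
have [r0 r1] := andP r01; have [C hC] := summable r01.
exists (C / rho ^+ 2); exists ((1 - normc w) / 2); first by lra.
move=> z zw.
have zr : normc z <= rho.
  rewrite -(subrK w z); apply: (le_trans (le_normcD _ _)).
  by rewrite /rho; lra.
have z1 : disk 1 z by rewrite /disk/= (le_lt_trans zr).
pose rem N := trunc N z - trunc N w - (trunc_dz p a b N w * (z - w)
     + trunc_dzbar p a b N w * conjc (z - w)).
apply: (@ccvg_normc_le _ rem) => [|N]; last exact: trunc_taylor.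
apply: ccvgD; last first.
  by apply: ccvgN; apply: ccvgD; apply: ccvgM => //; exact: ccvg_cst.
by apply: ccvgD; [exact: trunc_cvg|apply: ccvgN; exact: trunc_cvg].
Qed.

Lemma jac_limit w : disk 1 w ->
  (fun N => normc (trunc_dz p a b N w) ^+ 2 - normc (trunc_dzbar p a b N w) ^+ 2)
    @ \oo --> jac F w.
Proof.
move=> w1; have [P [Q [hP hQ]]] := trunc_derivatives_cvg w1.
have [dP dQ] := wirtinger_dz (limit_wirtinger w1 hP hQ).
by rewrite /jac dP dQ; apply: cvgB; exact: ccvg_normc_sqr.
Qed.

(** Dominated convergence: on the disk of radius r the Jacobians of the
    truncations are bounded by a constant. *)
Lemma area_limit r : 0 < r < 1 ->
  (fun N => (\sum_(j < N) area_term p a b r j)%:E) @ \oo --> area F r.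
Proof.
move=> r01; have [r0 r1] := andP r01; have [C hC] := summable r01.
have mD := measurable_planar_disk r0.
pose f_ N (w : measurableTypeR R * measurableTypeR R) : \bar R :=
  (normc (trunc_dz p a b N (cpt w)) ^+ 2 - normc (trunc_dzbar p a b N (cpt w))
    ^+ 2)%:E.
pose f (w : measurableTypeR R * measurableTypeR R) : \bar R := (jac F (cpt w))%:E.
have mf N : measurable_fun (planar_disk r) (f_ N).
  exact: (measurable_int _ (area_truncated p a b N r0).1).
have ff w : planar_disk r w -> f_ ^~ w @ \oo --> f w.
  move=> wr; apply: cvg_EFin; first exact: nearW.
  by apply: jac_limit; exact: lt_trans r1.
pose K := (C / r) ^+ 2 + (C / r) ^+ 2.
have iK : mu2.-integrable (planar_disk r) (EFin \o cst K).
  apply: measurable_bounded_integrable => //; first exact: planar_disk_finite.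
  exists `|K|; split; first exact: num_real.
  by move=> M KM w _ /=; exact: ltW.
have fK w N : planar_disk r w -> (`|f_ N w| <= (EFin \o cst K) w)%E.
  move=> wr; rewrite /f_ /= lee_fin.
  have [h1 h2] := trunc_derivatives_bound N r0 (ltW wr) hC.
  apply: (le_trans (ler_normB _ _)); rewrite !ger0_norm ?sqr_ge0//.
  by apply: lerD; rewrite lerXn2r// ?nnegrE ?normc_ge0// (le_trans _ h1)//
    normc_ge0.
have [_ _] := dominated_convergence mD mf (emeasurable_fun_cvg _ _ mf ff)
  (aeW _ ff) iK (aeW _ (fun w N => @fK w N)).
have -> : (fun N => \int[mu2]_(w in planar_disk r) f_ N w)%E =
    (fun N => (pi * \sum_(j < N) area_term p a b r j)%:E).
  apply/funext => N; have [iN <-] := area_truncated p a b N r0.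
  by rewrite /Rintegral fineK//; exact: integrable_fin_num.
move=> lim; rewrite /area.
have -> : (fun N => (\sum_(j < N) area_term p a b r j)%:E) =
    (fun N => (pi^-1)%:E * (pi * \sum_(j < N) area_term p a b r j)%:E)%E.
  apply/funext => N; rewrite -EFinM mulrA mulVf ?mul1r//.
  by rewrite gt_eqF// pi_gt0.
exact: cvgeZl lim.
Qed.

End TruncationLimit.

(** * A three circles inequality *)

Section Convexity.
Variable R : realType.

(** At the weighted mean A of u and v, the graph of the exponential lies above
    its tangent, and the weighted mean of the tangent at u and v is its value
    at A. *)
Lemma weighted_AMGM_expR (t u v : R) : 0 <= t <= 1 ->
  expR (t * u + (1 - t) * v) <= t * expR u + (1 - t) * expR v.
Proof.
move=> /andP[t0 t1]; set A := t * u + (1 - t) * v.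
(* A common factor expR A reduces the claim to the tangent at 0. *)
have -> : u = A + (u - A) by ring.
have -> : v = A + (v - A) by ring.
rewrite ![expR (A + _)]expRD mulrCA [_ * (expR A * _)]mulrCA -mulrDr.
rewrite ler_peMr ?expR_ge0//.
have t1' : 0 <= 1 - t by rewrite subr_ge0.
apply: le_trans (lerD (ler_wpM2l t0 (expR_ge1Dx _)) (ler_wpM2l t1' (expR_ge1Dx
  _))).
by rewrite le_eqVlt; apply/orP; left; apply/eqP; rewrite /A; ring.
Qed.

(** Hadamard's inequality for a polynomial with nonnegative coefficients; the
    bound at s < 1 extends to s = 1 by continuity. *)
Lemma three_circles_sum (I : finType) (K : I -> R) (e : I -> nat) (m r1 r : R) :
  (forall i, 0 <= K i) -> 0 < m -> 0 < r1 -> r1 <= r < 1 ->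
  \sum_i K i * r1 ^+ e i <= m ->
  (forall s, 0 < s < 1 -> \sum_i K i * s ^+ e i <= 1) ->
  \sum_i K i * r ^+ e i <= m `^ (ln r / ln r1).
Proof.
move=> K0 m0 r10 /andP[r1r r_lt1] Tr1 Ts.
have r0 : 0 < r by exact: lt_le_trans r1r.
have lr : ln r < 0 by rewrite ln_lt0// r0.
have lr1 : ln r1 < 0 by rewrite ln_lt0// r10 (le_lt_trans r1r).
set t := ln r / ln r1.
have t01 : 0 <= t <= 1.
  rewrite /t ler_ndivrMr// ler_ndivlMr// mul0r mul1r ltW//=.
  by rewrite ler_ln// posrE.
have [t0 t1] := andP t01.
have T1 : \sum_i K i <= 1.
  have c : (fun s : R => \sum_i K i * s ^+ e i) @ 1^'- --> \sum_i K i * 1 ^+ e i.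
    have E (s : R) : \sum_i K i * s ^+ e i = (\sum_i K i *: 'X^(e i)).[s].
      by rewrite horner_sum; apply: eq_bigr => i _; rewrite hornerZ hornerXn.
    rewrite E (funext E); apply: cvg_at_left_filter; exact: continuous_horner.
  rewrite (eq_bigr (fun i => K i * 1 ^+ e i)) => [|i _];
    last by rewrite expr1n mulr1.
  apply: (cvgr_to_le c); near=> s; apply: Ts; apply/andP; split.
    by near: s; exact: nbhs_left_gt.
  by near: s; exact: nbhs_left_lt.
have term i : m `^ (1 - t) * r ^+ e i <= t * r1 ^+ e i + (1 - t) * m.
  have tl : t * ln r1 = ln r by rewrite /t divfK// lt_eqF.
  have E (x : R) : 0 < x -> expR ((e i)%:R * ln x) = x ^+ e i.
    by move=> x0; rewrite expRM_natl lnK.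
  have := weighted_AMGM_expR ((e i)%:R * ln r1) (ln m) t01.
  by rewrite expRD mulrCA tl !E// lnK ?posrE// mulrC /powR gt_eqF.
have mt : 0 < m `^ (1 - t) by exact: powR_gt0.
rewrite -(ler_pM2l mt) -powRD; last by rewrite (gt_eqF m0) implybT.
rewrite subrK powRr1 ?(ltW m0)// mulr_sumr.
apply: (@le_trans _ _ (\sum_i K i * (t * r1 ^+ e i + (1 - t) * m))).
  by apply: ler_sum => i _; rewrite mulrCA ler_wpM2l.
have -> : \sum_i K i * (t * r1 ^+ e i + (1 - t) * m) =
    t * (\sum_i K i * r1 ^+ e i) + (1 - t) * m * \sum_i K i.
  by rewrite !mulr_sumr -big_split; apply: eq_bigr => i _ /=; ring.
apply: (@le_trans _ _ (t * m + (1 - t) * m * 1)); last first.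
  by rewrite mulr1 -mulrDl addrC subrK mul1r.
apply: lerD; first by rewrite ler_wpM2l.
by rewrite ler_wpM2l// mulr_ge0 ?(ltW m0)// subr_ge0.
Unshelve. all: by end_near. Qed.

End Convexity.

(** * Half-planes in terms of the argument *)

Section Argument.
Variable R : realType.
Implicit Types z u v : R[i].

Lemma carg_le_pihalf z : z != 0 -> `|carg z| <= pi / 2 -> 0 <= complex.Re z.
Proof.
move=> z0; have [_ zE] := cargP z0; rewrite ler_norml => h.
by rewrite zE /= mulr_ge0 ?normc_ge0 ?cos_ge0_pihalf.
Qed.

Lemma carg_ge_pihalf z : z != 0 -> pi / 2 <= `|carg z| -> complex.Re z <= 0.
Proof.
move=> z0; have [/andP[c1 c2] zE] := cargP z0 => h.
have cpi : `|carg z| <= pi by rewrite ler_norml c2 ltW.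
rewrite zE /= mulr_ge0_le0 ?normc_ge0//.
have -> : cos (carg z) = cos (- `|carg z|).
  by rewrite cosN; case: (ger0P (carg z)) => // _; rewrite cosN.
rewrite -oppr_ge0 -cosDpi; apply: cos_ge0_pihalf.
have pi0 := pi_gt0 R; apply/andP; split; lra.
Qed.

Lemma Re_mulJ_div u v : v != 0 ->
  complex.Re (u * conjc v) = normc v ^+ 2 * complex.Re (u / v).
Proof.
move=> v0; have -> : u * conjc v = (normc v ^+ 2)%:C * (u / v).
  by rewrite -mulcJ; field.
by rewrite [LHS]ReM /= mul0r subr0.
Qed.

End Argument.

(** * The area function of the map *)

Lemma area_term_nneg_coefficients (R : realType) (p j : nat) (a b : nat -> nat
  -> R[i]) :
  (forall n, (n < p)%N -> normc (b n j) <= normc (a n j)) ->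
  (forall n k, (n < p)%N -> (k < p)%N -> n <> k -> a n j <> 0 -> a k j <> 0 ->
     `|carg (a n j / a k j)| <= pi / 2) ->
  (forall n k, (n < p)%N -> (k < p)%N -> n <> k -> b n j <> 0 -> b k j <> 0 ->
     pi / 2 <= `|carg (b n j / b k j)|) ->
  forall n k, (n < p)%N -> (k < p)%N ->
  0 <= complex.Re (a n j * conjc (a k j) - b n j * conjc (b k j)).
Proof.
move=> ba ha hb n k np kp; rewrite ReD ReN subr_ge0.
have [<-{k kp}|/eqP nk] := eqVneq n k.
  by rewrite !mulcJ /= lerXn2r ?nnegrE ?normc_ge0 ?ba.
apply: (@le_trans _ _ 0).
  have [->|/eqP bn0] := eqVneq (b n j) 0; first by rewrite mul0r.
  have [->|/eqP bk0] := eqVneq (b k j) 0; first by rewrite conjc0 mulr0.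
  rewrite Re_mulJ_div; last exact/eqP.
  rewrite mulr_ge0_le0 ?sqr_ge0// carg_ge_pihalf ?hb//.
  by rewrite mulf_neq0 ?invr_eq0//; exact/eqP.
have [->|/eqP an0] := eqVneq (a n j) 0; first by rewrite mul0r.
have [->|/eqP ak0] := eqVneq (a k j) 0; first by rewrite conjc0 mulr0.
rewrite Re_mulJ_div; last exact/eqP.
rewrite mulr_ge0 ?sqr_ge0// carg_le_pihalf ?ha//.
by rewrite mulf_neq0 ?invr_eq0//; exact/eqP.
Qed.

(** Factoring |z|^(2n) out of the terms of index n leaves the partial sums of
    the power series h and g. *)
Lemma trunc_cvg_sum (R : realType) (p : nat) (a b : nat -> nat -> R[i])
    (h g : nat -> R[i] -> R[i]) (z : R[i]) : disk 1 z ->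
  (forall n, (1 <= n <= p)%N -> power_series_sum (a n) (h n)) ->
  (forall n, (1 <= n <= p)%N -> power_series_sum (b n) (g n)) ->
  ccvg (fun N => trunc p (fun n j => a n.+1 j.+1) (fun n j => b n.+1 j.+1) N z)
    (\sum_(1 <= n < p.+1)
       (normc z ^+ (2 * n.-1)%N)%:C * (h n z + conjc (g n z))).
Proof.
move=> z1 ah bg; rewrite big_add1 big_mkord/=.
pose S (c : nat -> nat -> R[i]) n N := \sum_(1 <= j < N.+1) c n j * z ^+ j.
have -> : (fun N => trunc p (fun n j => a n.+1 j.+1) (fun n j => b n.+1 j.+1) N
  z) =
  (fun N => \sum_(n < p) (normc z ^+ (2 * n)%N)%:C * (S a n.+1 N + conjc (S b
    n.+1 N))).
  apply/funext => N; rewrite /trunc exchange_big/=; apply: eq_bigr => n _.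
  have -> : (normc z ^+ (2 * n)%N)%:C = z ^+ n * conjc z ^+ n.
    by rewrite exprM rmorphXn /= -mulcJ exprMn.
  rewrite /S !big_add1 !big_mkord/= rmorph_sum -big_split/=.
  rewrite mulr_sumr; apply: eq_bigr => j _.
  by rewrite /mono !exprD rmorphM rmorphXn /=; ring.
have sc (c : nat -> nat -> R[i]) (f : nat -> R[i] -> R[i]) (n : 'I_p) :
    (forall n, (1 <= n <= p)%N -> power_series_sum (c n) (f n)) ->
    ccvg (S c n.+1) (f n.+1 z).
  by move=> cf; apply: ccvg_cvg; apply: cf => //=.
apply: ccvg_sum => n; apply: ccvgM; first exact: ccvg_cst.
by apply: ccvgD; [exact: sc ah|apply: ccvgJ; exact: sc bg].
Qed.

Lemma weight_summable (R : realType) (p : nat) (a b : nat -> nat -> R[i])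
    (h g : nat -> R[i] -> R[i]) (rho : R) : 0 < rho < 1 ->
  (forall n, (1 <= n <= p)%N -> power_series_sum (a n) (h n)) ->
  (forall n, (1 <= n <= p)%N -> power_series_sum (b n) (g n)) ->
  exists C, forall N, \sum_(j < N) \sum_(n < p)
    weight (fun n j => a n.+1 j.+1) (fun n j => b n.+1 j.+1) rho j n <= C.
Proof.
move=> r01 ah bg.
have /choice[C hC] : forall n : 'I_p, exists C, forall N, \sum_(j < N)
    weight (fun n j => a n.+1 j.+1) (fun n j => b n.+1 j.+1) rho j n <= C.
  move=> n; have np : (1 <= n.+1 <= p)%N := ltn_ord n.
  have [Ca hA] := power_series_summable (n + n) (ah _ np) r01.
  have [Cb hB] := power_series_summable (n + n) (bg _ np) r01.
  exists (Ca + Cb) => N; apply: (le_trans _ (lerD (hA N) (hB N))).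
  rewrite -big_split; apply: ler_sum => j _.
  by rewrite /weight /= mulrDl addnA.
exists (\sum_n C n) => N; rewrite exchange_big; exact: ler_sum.
Qed.

Theorem theorem5 (R : realType) (m r1 : R) (p : nat)
    (a b : nat -> nat -> R[i]) (h g : nat -> R[i] -> R[i]) (F : R[i] -> R[i]) :
  0 < m < 1 ->
  0 < r1 < 1 ->
  (1 <= p)%N ->
  polyharmonic p (disk 1) F ->
  (forall n, (1 <= n <= p)%N -> power_series_sum (a n) (h n)) ->
  (forall n, (1 <= n <= p)%N -> power_series_sum (b n) (g n)) ->
  (forall z, disk 1 z ->
     F z = \sum_(1 <= n < p.+1)
             (normc z ^+ (2 * n.-1)%N)%:C * (h n z + conjc (g n z))) ->
  (area F r1 <= m%:E)%E ->
  (area1 F <= 1)%E ->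
  (forall n j, (1 <= n <= p)%N -> (1 <= j)%N ->
     normc (b n j) <= normc (a n j)) ->
  (forall j n1 n2, (1 <= j)%N -> (1 <= n1 <= p)%N -> (1 <= n2 <= p)%N ->
     n1 <> n2 -> a n1 j <> 0 -> a n2 j <> 0 ->
     `|carg (a n1 j / a n2 j)| <= pi / 2) ->
  (forall j n1 n2, (1 <= j)%N -> (1 <= n1 <= p)%N -> (1 <= n2 <= p)%N ->
     n1 <> n2 -> b n1 j <> 0 -> b n2 j <> 0 ->
     pi / 2 <= `|carg (b n1 j / b n2 j)|) ->
  forall r : R, r1 <= r < 1 ->
    (area F r <= (m `^ (ln r / ln r1))%:E)%E.
Proof.
move=> /andP[m0 _] /andP[r10 r11] _ _ ah bg FE Fr1 F1 ba arga argb r /andP[r1r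
  rlt1].
pose a' n j := a n.+1 j.+1; pose b' n j := b n.+1 j.+1.
have area_cvg s : 0 < s < 1 ->
    (fun N => (\sum_(j < N) area_term p a' b' s j)%:E) @ \oo --> area F s.
  apply: area_limit => [z z1|rho rho01]; last exact: weight_summable ah bg.
  by rewrite FE//; exact: trunc_cvg_sum.
pose K N (i : 'I_N * ('I_p * 'I_p)) := complex.Re
  (a' i.2.1 i.1 * conjc (a' i.2.2 i.1) - b' i.2.1 i.1 * conjc (b' i.2.2 i.1)) *
  i.1.+1%:R.
pose e N (i : 'I_N * ('I_p * 'I_p)) := (2 * (i.1.+1 + i.2.1 + i.2.2))%N.
have TE s N : \sum_(j < N) area_term p a' b' s j = \sum_i K N i * s ^+ e N i.
  rewrite -(pair_bigA _ (fun j i => K N (j, i) * s ^+ e N (j, i)))/=.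
  apply: eq_bigr => j _; rewrite /area_term pair_bigA; apply: eq_bigr => -[n k] _.
  by rewrite mulrA.
have cf_ge0 j n k : (n < p)%N -> (k < p)%N ->
    0 <= complex.Re (a' n j * conjc (a' k j) - b' n j * conjc (b' k j)).
  apply: area_term_nneg_coefficients => [n' np|n1 n2 h1 h2 n12|n1 n2 h1 h2 n12].
  - exact: ba.
  - by apply: arga => // -[].
  - by apply: argb => // -[].
have K0 N i : 0 <= K N i by rewrite mulr_ge0// cf_ge0.
have partial_le s N : 0 < s < 1 ->
    ((\sum_(j < N) area_term p a' b' s j)%:E <= area F s)%E.
  move=> s01; apply: (cvge_ge _ (area_cvg _ s01)); exists N => //= M NM.
  rewrite lee_fin -(subnKC NM) big_split_ord/= lerDl.
  apply: sumr_ge0 => j _; apply: sumr_ge0 => n _; apply: sumr_ge0 => k _.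
  rewrite mulr_ge0 ?cf_ge0// mulr_ge0// exprn_ge0//.
  by case/andP: s01 => /ltW.
have r01 : 0 < r < 1 by rewrite (lt_le_trans r10).
apply: (cvge_le _ (area_cvg _ r01)); apply: nearW => N.
rewrite lee_fin TE; apply: three_circles_sum => //.
- by rewrite r1r.
- by rewrite -TE -lee_fin (le_trans (partial_le _ _ _)) ?r10.
- move=> s s01; rewrite -TE -lee_fin (le_trans (partial_le _ _ s01))//.
  by apply: le_trans F1; apply: ereal_sup_ubound; exists s.
Qed.
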